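(* Let $d\ge1$, let $\alpha\in(1,\infty)$ be a constant, and let $(L_t)_{t\ge0}$ be a Lévy process in $\mathbb{R}^d$ whose Lévy measure $\nu$ is absolutely continuous with respect to Lebesgue measure on the ball $B_1(0)=\{x\in\mathbb{R}^d\colon|x|<1\}$ and satisfies $$\frac{\nu(\mathrm{d}x)}{\mathrm{d}x}\ge\frac{\left|\log_2|x|\right|^{2\alpha}}{|x|^d},\qquad x\in B_1(0).$$ Let $P_tf(x)=\mathbb{E}\,f(x+L_t)$ be its transition semigroup. Then $(L_t)_{t\ge0}$ is strong Feller. Moreover, there exists $r_0>0$ such that for every $t>0$ and every $f\in B_b(\mathbb{R}^d)$, $$|P_tf(x)-P_tf(y)|\le\frac{C}{\left|\log_2|x-y|\right|^{\alpha-1}}\qquad\text{for all }x,y\in\mathbb{R}^d\text{ with }0<|x-y|\le r_0,$$ where $C$ depends on $\alpha$, $d$, $t$, $r_0$ and $\|f\|_\infty$.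
   Context: $B_b(\mathbb{R}^d)$ is the space of bounded Borel measurable functions $f\colon\mathbb{R}^d\to\mathbb{R}$, $\|f\|_\infty=\sup_x|f(x)|$, and $C_b(\mathbb{R}^d)$ is the space of bounded continuous functions. The Lévy measure of $L$ is the measure $\nu$ in its Lévy–Khinchin triplet; it satisfies $\nu(\{0\})=0$ and $\int_{\mathbb{R}^d}1\wedge|y|^2\,\nu(\mathrm{d}y)<\infty$. The process is called strong Feller if $P_t$ maps $B_b(\mathbb{R}^d)$ into $C_b(\mathbb{R}^d)$ for every $t>0$. *)

(* Defs.v *)
From HB Require Import structures.
From mathcomp Require Import all_boot all_order all_algebra.
From mathcomp Require Import complex.
From mathcomp Require Import all_classical all_reals all_analysis.
From mathcomp Require Import measurable_realfun.

Set Implicit Arguments.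
Unset Strict Implicit.
Unset Printing Implicit Defensive.

Import Order.TTheory GRing.Theory Num.Theory.
Import numFieldNormedType.Exports.

Local Open Scope classical_set_scope.
Local Open Scope ring_scope.

(* Borel sigma-algebra of a space of matrices; R^d is ['rV[R]_d]. *)
HB.instance Definition _ (R : realType) (m n : nat) :=
  @isMeasurable.Build (sigma_display (@open 'M[R]_(m, n))) 'M[R]_(m, n)
    <<s @open 'M[R]_(m, n) >> (@sigma_algebra0 _ _ _) (@sigma_algebraC _ _)
    (@sigma_algebra_bigcup _ _ _).

Section borel_rV.
Context {R : realType} {d : nat}.

Lemma measurable_rVE :
  @measurable _ 'rV[R]_d = <<s @open 'rV[R]_d >>.
Proof. by []. Qed.

Lemma measurable_coord (i : 'I_d) :
  measurable_fun [set: 'rV[R]_d] (fun x => x 0 i).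
Proof.
apply: (measurability _ (RGenOpens.measurableE R)) => _ [_ [a [b ->]] <-].
rewrite setTI; apply: sub_sigma_algebra => /=.
apply: (@open_comp _ _ (fun x : 'rV[R]_d => x 0 i)).
  by move=> x _; exact: coord_continuous.
exact: interval_open.
Qed.

Let box (p : 'rV[rat]_d * rat) : set 'rV[R]_d :=
  [set x | forall i, `|x 0 i - ratr (p.1 0 i)| < ratr p.2].

Lemma open_rV_bigcup_box (U : set 'rV[R]_d) : open U ->
  U = \bigcup_(p in [set p | box p `<=` U]) box p.
Proof.
move=> oU; apply/seteqP; split => [x Ux|x [p /= pU]]; last exact: pU.
have : nbhs x U by exact: open_nbhs_nbhs.
move=> /nbhs_ballP[e /= e0 xeU].
have /rat_in_itvoo[r /itvP re] : 0 < e / 2 by rewrite divr_gt0.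
have r0 : 0 < ratr r :> R by rewrite re.
have xq i : exists q : rat, `|x 0 i - ratr q| < ratr r.
  have /rat_in_itvoo[q /itvP qe] : x 0 i - ratr r < x 0 i + ratr r.
    by rewrite ltrBlDr -addrA ltrDl addr_gt0.
  by exists q; rewrite distrC ltr_distl !qe.
pose q := \row_i sval (cid (xq i)).
exists (q, r); last by move=> i /=; rewrite mxE; case: cid.
move=> y /= yq; apply: xeU; split => // i j; rewrite ord1.
rewrite /ball/= -[x 0 j](subrK (ratr (q 0 j))) -addrA.
rewrite (le_lt_trans (ler_normD _ _))// [e]splitr ltrD//.
  by rewrite mxE; case: cid => /= ? /lt_trans; apply; rewrite re.
by rewrite distrC (lt_trans (yq j))// re.
Qed.

Lemma measurable_fun_rV d' (T : measurableType d') (f : T -> 'rV[R]_d) :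
  (forall i, measurable_fun setT (fun x => f x 0 i)) -> measurable_fun setT f.
Proof.
move=> mf; apply: (measurability _ measurable_rVE) => _ [U oU <-].
rewrite setTI (open_rV_bigcup_box oU) preimage_bigcup bigcup_mkcond.
apply: countable_bigcupT_measurable => [|p]; first exact: countableP.
case: ifPn => // _.
rewrite (_ : _ @^-1` _ = \bigcap_(i in [set: 'I_d])
    (fun x => f x 0 i) @^-1`
      `]ratr (p.1 0 i) - ratr p.2, ratr (p.1 0 i) + ratr p.2[).
  apply: fin_bigcap_measurable => // i _.
  by rewrite -[X in measurable X]setTI; exact: mf.
apply/seteqP; split => x /= => [h i _|h i].
  by have := h i; rewrite /= in_itv/= ltr_distl.
by have := h i I; rewrite /= in_itv/= ltr_distl.
Qed.

End borel_rV.

Section lebesgue_rV.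
Context {R : realType}.

Definition cons_rV d (p : R * 'rV[R]_d) : 'rV[R]_d.+1 :=
  \row_i if unlift ord0 i is Some j then p.2 0 j else p.1.

Lemma cons_rV0 d p : @cons_rV d p 0 ord0 = p.1.
Proof. by rewrite mxE unlift_none. Qed.

Lemma cons_rVS d p (i : 'I_d) : @cons_rV d p 0 (lift ord0 i) = p.2 0 i.
Proof. by rewrite mxE liftK. Qed.

Lemma measurable_cons_rV d : measurable_fun setT (@cons_rV d).
Proof.
apply: measurable_fun_rV => i; case: (unliftP ord0 i) => [j|] ->.
  under eq_fun do rewrite cons_rVS.
  exact: (measurableT_comp (measurable_coord j) measurable_snd).
by under eq_fun do rewrite cons_rV0; exact: measurable_fst.
Qed.

Definition uncons_rV d (x : 'rV[R]_d.+1) : R * 'rV[R]_d :=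
  (x 0 ord0, \row_i x 0 (lift ord0 i)).

Lemma measurable_uncons_rV d : measurable_fun setT (@uncons_rV d).
Proof.
apply/measurable_fun_pairP; split => /=; first exact: measurable_coord.
apply: measurable_fun_rV => i.
by under eq_fun do rewrite /= mxE; exact: measurable_coord.
Qed.

Lemma cons_rVK d : cancel (@cons_rV d) (@uncons_rV d).
Proof.
move=> [a x]; rewrite /uncons_rV cons_rV0; congr pair.
by apply/rowP => i; rewrite mxE cons_rVS.
Qed.

Local Open Scope ereal_scope.

Definition lebesgue_cons d (m : {sigma_finite_measure set 'rV[R]_d -> \bar R}) :
    set 'rV[R]_d.+1 -> \bar R :=
  pushforward (@lebesgue_measure R \x m) (@cons_rV d).

Section lebesgue_cons_measure.
Variables (d : nat) (m : {sigma_finite_measure set 'rV[R]_d -> \bar R}).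

Let lebesgue_cons0 : lebesgue_cons m set0 = 0.
Proof. by rewrite /lebesgue_cons /pushforward preimage_set0 measure0. Qed.

Let lebesgue_cons_ge0 A : 0 <= lebesgue_cons m A.
Proof. by rewrite /lebesgue_cons /pushforward; exact: integral_ge0. Qed.

Let measurable_preimage_cons A : measurable A -> measurable (@cons_rV d @^-1` A).
Proof.
by move=> mA; rewrite -[X in measurable X]setTI; exact: measurable_cons_rV.
Qed.

Let lebesgue_cons_sigma_additive : semi_sigma_additive (lebesgue_cons m).
Proof.
move=> F mF tF mUF; rewrite /lebesgue_cons /pushforward preimage_bigcup.
apply: measure_semi_sigma_additive.
- by move=> n; exact: measurable_preimage_cons.
- by move/trivIsetP: tF => tF; apply/trivIsetP => i j _ _ /tF tij;
    rewrite -preimage_setI tij// preimage_set0.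
- by rewrite -preimage_bigcup; exact: measurable_preimage_cons.
Qed.

HB.instance Definition _ := isMeasure.Build _ _ _ (lebesgue_cons m)
  lebesgue_cons0 lebesgue_cons_ge0 lebesgue_cons_sigma_additive.

Let lebesgue_cons_sigma_finite : sigma_finite setT (lebesgue_cons m).
Proof.
have /sigma_finiteP[F [FT ndF Foo]] := sigma_finiteT (@lebesgue_measure R).
have /sigma_finiteP[G [GT ndG Goo]] := sigma_finiteT m.
exists (fun n => @uncons_rV d @^-1` (F n `*` G n)) => [|n].
  apply/seteqP; split => // x _.
  have [i _ Fi] : (\bigcup_i F i) (uncons_rV x).1 by rewrite -FT.
  have [j _ Gj] : (\bigcup_i G i) (uncons_rV x).2 by rewrite -GT.
  exists (maxn i j) => //; split.
    by move: Fi; exact/subsetPset/ndF/leq_maxl.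
  by move: Gj; exact/subsetPset/ndG/leq_maxr.
have [mF Fn] := Foo n; have [mG Gn] := Goo n; split.
  rewrite -[X in measurable X]setTI; apply: measurable_uncons_rV => //.
  exact: measurableX.
rewrite /lebesgue_cons /pushforward (_ : _ @^-1` _ = F n `*` G n).
  by rewrite product_measure1E// lte_mul_pinfty// ge0_fin_numE.
rewrite -comp_preimage (_ : _ \o _ = id) ?preimage_id//.
by apply/funext => x; exact: cons_rVK.
Qed.

HB.instance Definition _ := Measure_isSigmaFinite.Build _ _ _ (lebesgue_cons m)
  lebesgue_cons_sigma_finite.

End lebesgue_cons_measure.

Fixpoint lebesgue_rV d : {sigma_finite_measure set 'rV[R]_d -> \bar R} :=
  if d is d'.+1 return {sigma_finite_measure set 'rV[R]_d -> \bar R}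
  then lebesgue_cons (lebesgue_rV d')
  else \d_(0%R : 'rV[R]_0).

Lemma lebesgue_rV_box d (A : 'I_d -> set R) : (forall i, measurable (A i)) ->
  lebesgue_rV d [set x | forall i, A i (x 0%R i)] =
  \prod_(i < d) lebesgue_measure (A i).
Proof.
elim: d A => [|d IH] A mA /=.
  rewrite big_ord0 /dirac indicE mem_set//; by case.
rewrite big_ord_recl -IH; last by move=> i; exact: mA.
have mB : measurable [set x : 'rV[R]_d | forall i : 'I_d, A (lift ord0 i) (x 0%R i)].
  rewrite [X in measurable X](_ : _ = \bigcap_(i in [set: 'I_d])
      (fun x : 'rV[R]_d => x 0%R i) @^-1` A (lift ord0 i)).
    apply: fin_bigcap_measurable => // i _.
    by rewrite -[X in measurable X]setTI; exact: measurable_coord.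
  by apply/seteqP; split => x /= h i; [move=> _; exact: h|exact: (h i I)].
transitivity ((@lebesgue_measure R \x lebesgue_rV d)
    (A ord0 `*` [set x : 'rV[R]_d | forall i : 'I_d, A (lift ord0 i) (x 0%R i)])); last first.
  apply: (product_measure1E (@lebesgue_measure R) (lebesgue_rV d)) => //.
  exact: mA.
rewrite /lebesgue_cons /pushforward; congr (_ \x _).
apply/seteqP; split => p /=.
  move=> h; split => [|i]; first by have := h ord0; rewrite cons_rV0.
  by have := h (lift ord0 i); rewrite cons_rVS.
by move=> [h0 h] i; case: (unliftP ord0 i) => [j|] ->;
  rewrite ?cons_rVS ?cons_rV0.
Qed.

End lebesgue_rV.

Section euclidean.
Context {R : realType} {d : nat}.
Implicit Types x y : 'rV[R]_d.

Definition dotr x y : R := \sum_(i < d) x 0 i * y 0 i.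

(* The library norm on ['rV[R]_d] is the sup norm; it induces the same topology
   and Borel sigma-algebra as this one. *)
Definition enorm x : R := Num.sqrt (dotr x x).

Definition unit_eball : set 'rV[R]_d := [set x | enorm x < 1].

End euclidean.

Definition log2 {R : realType} (a : R) : R := ln a / ln 2.

Section complex_valued.
Context {R : realType}.
Local Open Scope complex_scope.

Definition cexp (z : R[i]) : R[i] :=
  (expR (complex.Re z) * cos (complex.Im z)) +i* (expR (complex.Re z) * sin (complex.Im z)).

Definition cintegral d (T : measurableType d) (mu : {measure set T -> \bar R})
    (f : T -> R[i]) : R[i] :=
  (\int[mu]_x complex.Re (f x)) +i* (\int[mu]_x complex.Im (f x)).

End complex_valued.

Section levy.
Context {R : realType} {d : nat} {dO : measure_display}.
Context {Omega : measurableType dO}.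
Variables (P : probability Omega R) (L : R -> Omega -> 'rV[R]_d).

Definition independent n (X : 'I_n -> Omega -> 'rV[R]_d) :=
  forall A : 'I_n -> set 'rV[R]_d, (forall i, measurable (A i)) ->
    P (\bigcap_(i in [set: 'I_n]) (X i @^-1` A i)) =
    (\prod_(i < n) P (X i @^-1` A i))%E.

Definition cadlag (X : R -> 'rV[R]_d) :=
  (forall t : R, 0 <= t -> X s @[s --> t^'+] --> X t) /\
  (forall t : R, 0 < t -> exists l : 'rV[R]_d, X s @[s --> t^'-] --> l).

(* Time is [0, +oo[: the values of [L] at negative times are irrelevant. *)
Record levy_process : Prop := {
  levy_measurable : forall t : R, 0 <= t -> measurable_fun setT (L t) ;
  levy_start : {ae P, forall w, L 0 w = 0} ;
  levy_independent_increments : forall n (t : nat -> R), 0 <= t 0%N ->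
    (forall i, (i < n)%N -> t i < t i.+1) ->
    independent (fun (i : 'I_n) w => L (t i.+1) w - L (t i) w) ;
  levy_stationary_increments : forall s t : R, 0 <= s -> 0 <= t ->
    forall A, measurable A ->
    P ((fun w => L (s + t) w - L s w) @^-1` A) = P (L t @^-1` A) ;
  levy_stochastically_continuous : forall t e : R, 0 <= t -> 0 < e ->
    P [set w | e < enorm (L s w - L t w)]
      @[s --> within [set s : R | 0 <= s] (nbhs t)] --> 0%E ;
  levy_cadlag : {ae P, forall w, cadlag (fun t => L t w)} }.

Definition charfun (X : Omega -> 'rV[R]_d) (u : 'rV[R]_d) : R[i] :=
  cintegral P (fun w => cexp (0 +i* dotr u (X w))%C).

(* The drift [b] depends on the truncation function, chosen here as the
   indicator of the closed unit ball; [A] and [nu] do not. *)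
Definition levy_exponent (b : 'rV[R]_d) (A : 'M[R]_d)
    (nu : {measure set 'rV[R]_d -> \bar R}) (u : 'rV[R]_d) : R[i] :=
  ((0 +i* dotr b u) - ((dotr u (u *m A)) / 2)%:C +
   cintegral nu (fun y => cexp (0 +i* dotr u y) - 1 -
     (0 +i* (dotr u y * (enorm y <= 1)%R%:R))))%C.

Record levy_khintchine_triplet (b : 'rV[R]_d) (A : 'M[R]_d)
    (nu : {measure set 'rV[R]_d -> \bar R}) : Prop := {
  triplet_sym : A^T = A ;
  triplet_psd : forall u, 0 <= dotr u (u *m A) ;
  triplet_nu0 : nu [set 0] = 0%E ;
  triplet_nu_integrable :
    (\int[nu]_y (Num.min 1 (enorm y ^+ 2))%:E < +oo)%E ;
  triplet_charfun : forall (t : R) u, 0 <= t ->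
    charfun (L t) u = cexp (t%:C%C * levy_exponent b A nu u) }.

Definition levy_measure (nu : {measure set 'rV[R]_d -> \bar R}) :=
  exists b A, levy_khintchine_triplet b A nu.

Definition semigroup (t : R) (f : 'rV[R]_d -> R) (x : 'rV[R]_d) : R :=
  \int[P]_w f (x + L t w).

Definition Bb : set ('rV[R]_d -> R) :=
  [set f : 'rV[R]_d -> R | measurable_fun setT f /\ bounded_fun f].

Definition Cb : set ('rV[R]_d -> R) :=
  [set f : 'rV[R]_d -> R | continuous f /\ bounded_fun f].

Definition strong_feller := forall t : R, 0 < t ->
  forall f, Bb f -> Cb (semigroup t f).

End levy.

Definition supnorm {R : realType} {T : Type} (f : T -> R) : R :=
  sup (range (fun x => `|f x|)).

Section densities.
Context {R : realType} {d : nat}.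
Implicit Types (nu : {measure set 'rV[R]_d -> \bar R}) (D : set 'rV[R]_d).

Definition abs_continuous_on nu D := forall A, measurable A -> A `<=` D ->
  lebesgue_rV d A = 0%E -> nu A = 0%E.

Definition density_on nu D (g : 'rV[R]_d -> \bar R) :=
  [/\ measurable_fun D g, forall x, D x -> (0 <= g x)%E &
    forall A, measurable A -> A `<=` D ->
      nu A = (\int[lebesgue_rV d]_(x in A) g x)%E].

End densities.

(* Main.v *)
(* On the cube [s, 2s]^d the density of nu is at least a constant k with
   k s^d = c |log2 (2 d s)|^(2 alpha), so the Levy process splits as a compound
   Poisson process with intensity k s^d and uniform jumps on the cube, plus an
   independent remainder. Translating by h changes the uniform law on the cube by
   O(|h| / s) in total variation, so it changes the law at time t of the compound
   Poisson process by at most 2 exp (- t k s^d) + O(|h| / s), the first term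
   accounting for the event that there is no jump; the remainder cannot increase
   this. The choice s = sqrt |h| gives the claim.

   The remainder is not constructed as a process. The transition operators act on
   trigonometric polynomials as Fourier multipliers, and what is needed is that
   the multiplier exp (t (psi - k rho)) is a contraction for the supremum norm,
   where psi is the Levy exponent and k rho that of the compound Poisson process.
   It is a pointwise limit of products of contractions: translations, a Gaussian
   multiplier, and compound Poisson multipliers exp (t chi), the latter being
   limits of the contractions (1 + t chi / n)^n. *)

Require Import Defs.
From HB Require Import structures.
From mathcomp Require Import all_boot all_order all_algebra.
From mathcomp Require Import complex.
From mathcomp Require Import all_classical all_reals all_analysis.
From mathcomp Require Import measurable_realfun.
From mathcomp Require Import zify ring lra.
Import Order.TTheory GRing.Theory Num.Theory.
Import numFieldNormedType.Exports.
Local Open Scope classical_set_scope.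
Local Open Scope ring_scope.

(** The triplet gives the law of [L t] through its characteristic function, and this is exactly the
    multiplier by which the transition operator acts on waves. The modulus of continuity at a
    displacement h is therefore a norm bound for the multiplier
    [charfun P (L t) u * (1 - wave u h)], and norms of multipliers add under sums, multiply under
    products and survive pointwise limits. With G the Fourier transform of k times Lebesgue measure
    on the cube and lam its mass, the multiplier factors as exp (t (psi - (G - lam))) exp (- t lam)
    [exp (t G) (1 - wave)]. A direct norm bound exp (t lam) for exp (t G) would only cancel the
    second factor; the gain comes from keeping 1 - wave next to G, where it becomes the difference
    of the cube weight and its translate. Trigonometric polynomials are not dense in the bounded
    Borel functions for the supremum norm, but iterated bounded pointwise limits of them reach every
    such function, and the final inequality passes to these limits by dominated convergence. *)

Notation normc := Normc.normc.

(** * Complex exponential *)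

Section trigonometric_bounds.
Context {R : realType}.
Implicit Types x y : R.

Lemma ler_norm_sin x : `|sin x| <= `|x|.
Proof.
wlog x0 : x / 0 <= x => [h|].
  have [/h//|/ltW x0] := leP 0 x.
  by rewrite -normrN -sinN -(normrN x); apply: h; rewrite oppr_ge0.
have [c _] : exists2 c, c \in `[0, x] & sin x - sin 0 = cos c * (x - 0).
  apply: MVT_segment => //.
  by apply/continuous_subspaceT => y; exact: continuous_sin.
rewrite sin0 !subr0 => ->.
by rewrite normrM ler_piMl// cos_max.
Qed.

(** Both sides of the minimum are used: [|x|] gives the quadratic bound for the cosine, and 1 gives
    the linear bound on the derivative of [sin x - x]. *)
Lemma norm_cosB1_le x : `|cos x - 1| <= `|x| * Num.min 1 `|x|.
Proof.
wlog x0 : x / 0 <= x => [h|].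
  have [/h//|/ltW x0] := leP 0 x.
  by rewrite -cosN -(normrN x); apply: h; rewrite oppr_ge0.
have [c] : exists2 c, c \in `[0, x] & cos x - cos 0 = - sin c * (x - 0).
  apply: MVT_segment => //.
  by apply/continuous_subspaceT => y; exact: continuous_cos.
rewrite cos0 subr0 in_itv/= => /andP[c0 cx] ->.
rewrite normrM normrN mulrC ler_wpM2l// le_min sin_max/=.
by rewrite (le_trans (ler_norm_sin _))// !ger0_norm// (le_trans c0).
Qed.

Lemma norm_cosB1_le_sqr x : `|cos x - 1| <= x ^+ 2.
Proof.
rewrite (le_trans (norm_cosB1_le x))// -real_normK ?num_real// expr2.
by rewrite ler_wpM2l// ge_min lexx orbT.
Qed.

Lemma norm_sinBx_le_sqr x : `|sin x - x| <= x ^+ 2.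
Proof.
wlog x0 : x / 0 <= x => [h|].
  have [/h//|/ltW x0] := leP 0 x.
  rewrite -normrN opprD -sinN -sqrrN; apply: h; by rewrite oppr_ge0.
have [c] : exists2 c, c \in `[0, x] &
    (sin x - x) - (sin 0 - 0) = (cos c - 1) * (x - 0).
  apply: (@MVT_segment _ (fun x => sin x - x) (fun c => cos c - 1)) => //.
  apply/continuous_subspaceT => y; apply: cvgB; last exact: cvg_id.
  exact: continuous_sin.
rewrite sin0 !subr0 in_itv/= => /andP[c0 cx] ->.
rewrite normrM (ger0_norm x0) expr2 ler_wpM2r//.
rewrite (le_trans (norm_cosB1_le c))// (ger0_norm c0) (le_trans _ cx)//.
by rewrite ler_piMr// ge_min lexx.
Qed.

(** From [1 - x <= expR (- x)] follows expR x <= 1 / (1 - x), whose remainder x^2 / (1 - x) is at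
    most 2 x^2 for x <= 1/2. *)
Lemma norm_expRB1Bx_le x : `|x| <= 1 / 2 -> `|expR x - 1 - x| <= 2 * x ^+ 2.
Proof.
move=> x12; have /andP[x1 x2] : - (1/2) <= x <= 1/2 by rewrite -ler_norml.
rewrite ger0_norm; last by have := expR_ge1Dx x; lra.
have e1 : expR x * (1 - x) <= 1.
  have := expR_ge1Dx (- x); rewrite expRN => h.
  rewrite -ler_pdivlMl ?expR_gt0// mulr1.
  by apply: le_trans h.
have e2 := expR_ge1Dx x.
nra.
Qed.

End trigonometric_bounds.

Section complex_exponential.
Context {R : realType}.
Implicit Types z w : R[i].

Lemma cexpD z w : cexp (z + w) = cexp z * cexp w.
Proof.
case: z => a b; case: w => c d; rewrite /cexp /=.
apply/eqP; rewrite eq_complex /=; apply/andP; split; apply/eqP;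
  rewrite expRD ?cosD ?sinD; ring.
Qed.

Lemma cexp0 : cexp 0 = 1 :> R[i].
Proof.
by rewrite /cexp /= expR0 cos0 sin0 mulr1 mulr0.
Qed.

Lemma cexpXn z n : cexp z ^+ n = cexp (z *+ n).
Proof.
elim: n => [|n IH]; first by rewrite expr0 mulr0n cexp0.
by rewrite exprS IH -cexpD mulrS.
Qed.

Lemma ReD z w : complex.Re (z + w) = complex.Re z + complex.Re w.
Proof. by case: z; case: w. Qed.
Lemma ImD z w : complex.Im (z + w) = complex.Im z + complex.Im w.
Proof. by case: z; case: w. Qed.
Lemma ReN z : complex.Re (- z) = - complex.Re z.
Proof. by case: z. Qed.
Lemma ImN z : complex.Im (- z) = - complex.Im z.
Proof. by case: z. Qed.
Lemma ReM z w : complex.Re (z * w) =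
  complex.Re z * complex.Re w - complex.Im z * complex.Im w.
Proof. by case: z; case: w. Qed.
Lemma ImM z w : complex.Im (z * w) =
  complex.Re z * complex.Im w + complex.Im z * complex.Re w.
Proof. by case: z; case: w. Qed.
Definition ReImE := (ReD, ImD, ReN, ImN, ReM, ImM).

Lemma complex_eqP z w :
  complex.Re z = complex.Re w -> complex.Im z = complex.Im w -> z = w.
Proof. by case: z => a b; case: w => c d /= -> ->. Qed.

Lemma normcE z : normc z ^+ 2 = complex.Re z ^+ 2 + complex.Im z ^+ 2.
Proof. by case: z => a b /=; rewrite sqr_sqrtr// addr_ge0// sqr_ge0. Qed.

Lemma normc_ge0 z : 0 <= normc z.
Proof. by case: z => a b /=; exact: sqrtr_ge0. Qed.

Lemma normc_le z : normc z <= `|complex.Re z| + `|complex.Im z|.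
Proof.
rewrite -(@ler_pXn2r _ 2)// ?nnegrE ?normc_ge0 ?addr_ge0// normcE sqrrD.
by rewrite !real_normK ?num_real// addrAC lerDl mulrn_wge0// mulr_ge0.
Qed.

Lemma le_Re_normc z : `|complex.Re z| <= normc z.
Proof.
rewrite -(@ler_pXn2r _ 2)// ?nnegrE ?normc_ge0// normcE real_normK ?num_real//.
by rewrite lerDl sqr_ge0.
Qed.

Lemma le_Im_normc z : `|complex.Im z| <= normc z.
Proof.
rewrite -(@ler_pXn2r _ 2)// ?nnegrE ?normc_ge0// normcE real_normK ?num_real//.
by rewrite lerDr sqr_ge0.
Qed.

Lemma normcX z n : normc (z ^+ n) = normc z ^+ n.
Proof.
elim: n => [|n IH]; first by rewrite !expr0 Normc.normc1.
by rewrite !exprS Normc.normcM IH.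
Qed.

Lemma normc_cexp z : normc (cexp z) = expR (complex.Re z).
Proof.
apply/eqP; rewrite -(@eqrXn2 _ 2)// ?normc_ge0 ?expR_ge0// normcE /=.
by apply/eqP; rewrite !exprMn -mulrDr cos2Dsin2 mulr1.
Qed.

Lemma normc_real (x : R) : normc x%:C%C = `|x|.
Proof. by rewrite /= expr0n/= addr0 sqrtr_sqr. Qed.

(** Each part is written so that every summand contains a second-order remainder of exp, cos or sin,
    or the product x sin y. The bounds add up to 2 x^2 + (3/2) y^2 + 2 |x| |y| + y^2, below 4 (x^2 +
    y^2). *)
Lemma normc_cexpB1Bz z : normc z <= 1 / 2 ->
  normc (cexp z - 1 - z) <= 4 * normc z ^+ 2.
Proof.
move=> hz; rewrite normcE; move: (le_Re_normc z) (le_Im_normc z) => h1 h2.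
rewrite (le_trans (normc_le _))//; case: z hz h1 h2 => x y /= hz h1 h2.
have hx := le_trans h1 hz; have hy := le_trans h2 hz.
have ex := norm_expRB1Bx_le x hx.
have cy := norm_cosB1_le_sqr y.
have sy := norm_sinBx_le_sqr y.
have cm := cos_max y; have sm := ler_norm_sin y.
rewrite subr0 -[expR x * cos y - 1 - x]/(expR x * cos y - 1 - x).
have -> : expR x * cos y - 1 - x =
  (expR x - 1 - x) * cos y + (1 + x) * (cos y - 1) by ring.
have -> : expR x * sin y - y =
  (expR x - 1 - x) * sin y + x * sin y + (sin y - y) by ring.
have a1 : `|(expR x - 1 - x) * cos y| <= 2 * x ^+ 2.
  by rewrite normrM (le_trans _ ex)// ler_piMr.
have a2 : `|(1 + x) * (cos y - 1)| <= 3/2 * y ^+ 2.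
  rewrite normrM ler_pM//; rewrite (le_trans (ler_normD _ _))// normr1; lra.
have ax0 := normr_ge0 x; have ay0 := normr_ge0 y.
have ex2 : x ^+ 2 = `|x| ^+ 2 by rewrite real_normK ?num_real.
have ey2 : y ^+ 2 = `|y| ^+ 2 by rewrite real_normK ?num_real.
have a3 : `|(expR x - 1 - x) * sin y| <= `|x| * `|y|.
  rewrite normrM ler_pM// (le_trans ex)// ex2; nra.
have a4 : `|x * sin y| <= `|x| * `|y| by rewrite normrM ler_wpM2l.
have b1 := ler_normD ((expR x - 1 - x) * cos y) ((1 + x) * (cos y - 1)).
have b2 := ler_normD ((expR x - 1 - x) * sin y + x * sin y) (sin y - y).
have b3 := ler_normD ((expR x - 1 - x) * sin y) (x * sin y).
have b4 : `|x| * `|y| *+ 2 <= `|x|^+2 + `|y|^+2.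
  by rewrite -subr_ge0 (_ : _ - _ = (`|x| - `|y|) ^+ 2) ?sqr_ge0//; ring.
rewrite mulr2n -ex2 -ey2 in b4.
apply: le_trans (lerD b1 b2) _.
apply: le_trans (lerD (lerD a1 a2) (lerD (le_trans b3 (lerD a3 a4)) sy)) _.
have := sqr_ge0 x; have := sqr_ge0 y; lra.
Qed.

Implicit Types zs ws : nat -> R[i].

(** By coordinates, as [cintegral] is, so that real limit theorems apply to each part. *)
Definition ccvg zs z :=
  (complex.Re (zs n) @[n --> \oo] --> complex.Re z) /\
  (complex.Im (zs n) @[n --> \oo] --> complex.Im z).

Lemma ccvg_cst z : ccvg (fun=> z) z.
Proof. by split; exact: cvg_cst. Qed.

Lemma ccvgD zs ws z w : ccvg zs z -> ccvg ws w ->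
  ccvg (fun n => zs n + ws n) (z + w).
Proof.
move=> [? ?] [? ?]; split.
  by under eq_fun do rewrite ReD; rewrite ReD; exact: cvgD.
by under eq_fun do rewrite ImD; rewrite ImD; exact: cvgD.
Qed.

Lemma ccvgM zs ws z w : ccvg zs z -> ccvg ws w ->
  ccvg (fun n => zs n * ws n) (z * w).
Proof.
move=> [? ?] [? ?]; split.
  under eq_fun do rewrite ReM.
  by rewrite ReM; apply: cvgB; exact: cvgM.
under eq_fun do rewrite ImM.
by rewrite ImM; apply: cvgD; exact: cvgM.
Qed.

Lemma ccvg_cexp zs z : ccvg zs z -> ccvg (fun n => cexp (zs n)) (cexp z).
Proof.
move=> [h1 h2]; split => /=; apply: cvgM.
- by apply: continuous_cvg => //; exact: continuous_expR.
- by apply: continuous_cvg => //; exact: continuous_cos.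
- by apply: continuous_cvg => //; exact: continuous_expR.
- by apply: continuous_cvg => //; exact: continuous_sin.
Qed.

Lemma ccvg_normc zs z : normc (zs n - z) @[n --> \oo] --> 0 -> ccvg zs z.
Proof.
move=> h; split; apply/cvgrPdist_le => e e0;
  move/cvgrPdist_le : h => /(_ e e0); apply: filterS => n;
  rewrite sub0r normrN (ger0_norm (normc_ge0 _)); apply: le_trans.
  by rewrite distrC -ReN -ReD le_Re_normc.
by rewrite distrC -ImN -ImD le_Im_normc.
Qed.

(** Telescoping: the factors z are exchanged for w one at a time, each exchange costing at most K^n
    |z - w|. *)
Lemma normc_subX (z w : R[i]) (K : R) n : normc z <= K -> normc w <= K ->
  normc (z ^+ n.+1 - w ^+ n.+1) <= n.+1%:R * K ^+ n * normc (z - w).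
Proof.
move=> zK wK; have K0 : 0 <= K by apply: le_trans zK; exact: normc_ge0.
elim: n => [|n IH]; first by rewrite !expr1 expr0 !mul1r.
have -> : z ^+ n.+2 - w ^+ n.+2 =
    z * (z ^+ n.+1 - w ^+ n.+1) + (z - w) * w ^+ n.+1.
  by rewrite (exprS z n.+1) (exprS w n.+1); ring.
rewrite (le_trans (@le_normcD _ _ _))// !Normc.normcM normcX.
have h1 : normc z * normc (z ^+ n.+1 - w ^+ n.+1) <=
    K * (n.+1%:R * K ^+ n * normc (z - w)).
  by apply: ler_pM => //; exact: normc_ge0.
have h2 : normc (z - w) * normc w ^+ n.+1 <= normc (z - w) * K ^+ n.+1.
  by rewrite ler_wpM2l ?normc_ge0// lerXn2r// ?nnegrE ?normc_ge0.
apply: (le_trans (lerD h1 h2)).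
rewrite -[n.+2%:R]natr1 exprS le_eqVlt; apply/orP; left; apply/eqP; ring.
Qed.

(** With N = n + 1, the limit is the N-th power of exp (z / N). Both bases have modulus at most exp
    (|z| / N) and differ by O(N^-2), so their N-th powers differ by O(1 / N). *)
Lemma ccvg_euler z : ccvg (fun n => (1 + z / n.+1%:R) ^+ n.+1) (cexp z).
Proof.
apply: ccvg_normc.
pose a := normc z; have a0 : 0 <= a by exact: normc_ge0.
apply: (@squeeze_cvgr _ _ _ _ (fun=> 0)
    (fun n => expR a * (4 * a ^+ 2) * n.+1%:R^-1)).
- near=> n; rewrite normc_ge0/=.
  pose N : R := n.+1%:R; have N0 : 0 < N by rewrite ltr0n.
  have nzN : normc (z / n.+1%:R) = a / N.
    rewrite Normc.normcM Normc.normcV; congr (_ * _^-1).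
    by rewrite -[X in normc X](rmorph_nat (real_complex R)) normc_real normr_nat.
  have zN : z = (z / n.+1%:R) *+ n.+1.
    by rewrite -mulr_natr divfK// pnatr_eq0.
  rewrite {2}zN -cexpXn.
  have h1 : normc (1 + z / n.+1%:R) <= expR (a / N).
    rewrite (le_trans (@le_normcD _ _ _))// Normc.normc1 nzN.
    exact: expR_ge1Dx.
  have h2 : normc (cexp (z / n.+1%:R)) <= expR (a / N).
    rewrite normc_cexp ler_expR -nzN (le_trans (ler_norm _))//.
    exact: le_Re_normc.
  rewrite (le_trans (normc_subX _ _ _ _ h1 h2))//.
  have -> : 1 + z / n.+1%:R - cexp (z / n.+1%:R) =
      - (cexp (z / n.+1%:R) - 1 - z / n.+1%:R) by ring.
  rewrite normcN.
  have h3 : normc (z / n.+1%:R) <= 1 / 2.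
    rewrite nzN ler_pdivrMr// mulrC mul1r ler_pdivlMr// mulrC.
    rewrite (@le_trans _ _ n%:R)// ?ler_nat//.
    by near: n; exact: nbhs_infty_ger.
  have := normc_cexpB1Bz _ h3; rewrite nzN => h4.
  have h5 : expR (a / N) ^+ n <= expR a.
    rewrite -expRM_natr ler_expR -mulrA ler_piMr// ler_pdivrMl// mulr1.
    by rewrite ler_nat.
  have h6 : N * expR (a / N) ^+ n * normc (cexp (z / n.+1%:R) - 1 - z / n.+1%:R)
     <= N * expR a * (4 * (a / N) ^+ 2).
    apply: ler_pM => //; first by rewrite mulr_ge0// ?ltW// exprn_ge0// expR_ge0.
      exact: normc_ge0.
    by rewrite ler_wpM2l// ltW.
  rewrite (le_trans h6)// le_eqVlt; apply/orP; left; apply/eqP.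
  by rewrite -/N; field; rewrite gt_eqF.
- exact: cvg_cst.
- rewrite -[X in _ --> X](mulr0 (expR a * (4 * a ^+ 2))).
  by apply: cvgM; [exact: cvg_cst|exact: cvg_harmonic].
Unshelve. all: by end_near. Qed.

End complex_exponential.

(** * Fourier multipliers on trigonometric polynomials *)

Section dot_product.
Context {R : realType} {d : nat}.
Implicit Types (u v x y : 'rV[R]_d) (a : R).

Lemma dotrC u x : dotr u x = dotr x u.
Proof. by apply: eq_bigr => i _; rewrite mulrC. Qed.

Lemma dotrDr u x y : dotr u (x + y) = dotr u x + dotr u y.
Proof. by rewrite -big_split; apply: eq_bigr => i _; rewrite mxE mulrDr. Qed.

Lemma dotrDl u v x : dotr (u + v) x = dotr u x + dotr v x.
Proof. by rewrite dotrC dotrDr !(dotrC x). Qed.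

Lemma dotrZr a u x : dotr u (a *: x) = a * dotr u x.
Proof. by rewrite mulr_sumr; apply: eq_bigr => i _; rewrite mxE; ring. Qed.

Lemma dotrZl a u x : dotr (a *: u) x = a * dotr u x.
Proof. by rewrite dotrC dotrZr dotrC. Qed.

Lemma dotrNr u x : dotr u (- x) = - dotr u x.
Proof. by rewrite -scaleN1r dotrZr mulN1r. Qed.

Lemma dotrNl u x : dotr (- u) x = - dotr u x.
Proof. by rewrite dotrC dotrNr dotrC. Qed.

Lemma dotr0r u : dotr u 0 = 0.
Proof. by rewrite -(scale0r 0) dotrZr mul0r. Qed.

Lemma dotr0l u : dotr 0 u = 0.
Proof. by rewrite dotrC dotr0r. Qed.

Lemma dotrxx_ge0 x : 0 <= dotr x x.
Proof. by apply: sumr_ge0 => i _; rewrite -expr2 sqr_ge0. Qed.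

Lemma enorm_ge0 x : 0 <= enorm x.
Proof. exact: sqrtr_ge0. Qed.

Lemma sqr_enorm x : enorm x ^+ 2 = dotr x x.
Proof. by rewrite sqr_sqrtr// dotrxx_ge0. Qed.

Lemma norm_coord_le_enorm x (i : 'I_d) : `|x 0 i| <= enorm x.
Proof.
rewrite -(@ler_pXn2r _ 2)// ?nnegrE ?enorm_ge0// sqr_enorm real_normK ?num_real//.
rewrite /dotr (bigD1 i)//= -expr2 lerDl; apply: sumr_ge0 => j _.
by rewrite -expr2 sqr_ge0.
Qed.

Lemma enorm_le_coord x a : 0 <= a -> (forall i, `|x 0 i| <= a) ->
  enorm x <= d%:R * a.
Proof.
move=> a0 xa; rewrite -(@ler_pXn2r _ 2)// ?nnegrE ?enorm_ge0 ?mulr_ge0//.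
rewrite sqr_enorm /dotr exprMn.
apply: (@le_trans _ _ (\sum_(i < d) a ^+ 2)).
  apply: ler_sum => i _; rewrite -expr2 -real_normK ?num_real//.
  by rewrite lerXn2r// nnegrE.
rewrite sumr_const card_ord -(mulr_natl (a ^+ 2)) ler_wpM2r ?exprn_ge0//.
by rewrite -natrX ler_nat; case: (d) => // n; rewrite expnS leq_pmulr.
Qed.

Lemma norm_dotr_le u x : `|dotr u x| <= (\sum_(i < d) `|u 0 i|) * enorm x.
Proof.
rewrite (le_trans (ler_norm_sum _ _ _))// mulr_suml ler_sum// => i _.
by rewrite normrM ler_wpM2l// norm_coord_le_enorm.
Qed.

End dot_product.

Section Fourier_multipliers.
Context {R : realType} {d : nat}.
Local Notation V := 'rV[R]_d.
Implicit Types (u x h : V) (p : seq (R[i] * V)) (m : V -> R[i]) (k M : R).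

Definition wave u x : R[i] := cexp (0 +i* dotr u x)%C.

Lemma Re_wave u x : complex.Re (wave u x) = cos (dotr u x).
Proof. by rewrite /= expR0 mul1r. Qed.

Lemma Im_wave u x : complex.Im (wave u x) = sin (dotr u x).
Proof. by rewrite /= expR0 mul1r. Qed.

Lemma waveDr u x y : wave u (x + y) = wave u x * wave u y.
Proof.
rewrite /wave -cexpD dotrDr; congr cexp.
by apply: complex_eqP; rewrite ReImE/= ?addr0.
Qed.

(** A list of pairs (coefficient, frequency), frequencies possibly repeated: a multiplier acts on
    the list, so no uniqueness of Fourier coefficients is involved. *)
Definition tpoly p x := \sum_(c <- p) complex.Re (c.1 * wave c.2 x).

Definition tmul m p := [seq (m c.2 * c.1, c.2) | c <- p].

(* [opbound m k]: the Fourier multiplier m has norm at most k for the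
   supremum norm on real trigonometric polynomials. *)
Definition opbound m k := forall p M, (forall x, `|tpoly p x| <= M) ->
  forall x, `|tpoly (tmul m p) x| <= k * M.

Lemma tpoly_tmul m p x :
  tpoly (tmul m p) x = \sum_(c <- p) complex.Re (m c.2 * c.1 * wave c.2 x).
Proof. by rewrite /tpoly big_map. Qed.

Lemma tmul_comp m1 m2 p : tmul (fun u => m1 u * m2 u) p = tmul m1 (tmul m2 p).
Proof. by rewrite /tmul -map_comp; apply: eq_map => c /=; rewrite mulrA. Qed.

Lemma tpoly_tmulD m1 m2 p x : tpoly (tmul (fun u => m1 u + m2 u) p) x =
  tpoly (tmul m1 p) x + tpoly (tmul m2 p) x.
Proof.
by rewrite !tpoly_tmul -big_split; apply: eq_bigr => c _; rewrite !mulrDl ReD.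
Qed.

Lemma tpoly_tmulZ k m p x : tpoly (tmul (fun u => k%:C%C * m u) p) x =
  k * tpoly (tmul m p) x.
Proof.
rewrite !tpoly_tmul mulr_sumr; apply: eq_bigr => c _.
by rewrite -!mulrA ReM/= mul0r subr0.
Qed.

Lemma tpoly_tmulB m1 m2 p x : tpoly (tmul (fun u => m1 u - m2 u) p) x =
  tpoly (tmul m1 p) x - tpoly (tmul m2 p) x.
Proof.
rewrite !tpoly_tmul -sumrB; apply: eq_bigr => c _.
by rewrite !mulrBl ReD ReN.
Qed.

Lemma tpoly_tmul1 p x : tpoly (tmul (fun=> 1) p) x = tpoly p x.
Proof. by rewrite tpoly_tmul; apply: eq_bigr => c _; rewrite mul1r. Qed.

Lemma tpoly_tmul_wave h p x :
  tpoly (tmul (wave ^~ h) p) x = tpoly p (x + h).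
Proof.
rewrite tpoly_tmul; apply: eq_bigr => c _.
by rewrite waveDr mulrC mulrA mulrAC; congr complex.Re; ring.
Qed.

Lemma eq_opbound m1 m2 k : m1 =1 m2 -> opbound m1 k -> opbound m2 k.
Proof. by move=> /funext ->. Qed.

Lemma opboundD m1 m2 k1 k2 : opbound m1 k1 -> opbound m2 k2 ->
  opbound (fun u => m1 u + m2 u) (k1 + k2).
Proof.
move=> h1 h2 p M pM x; rewrite tpoly_tmulD mulrDl (le_trans (ler_normD _ _))//.
by rewrite lerD//; [exact: h1|exact: h2].
Qed.

Lemma opboundM m1 m2 k1 k2 : opbound m1 k1 -> opbound m2 k2 ->
  opbound (fun u => m1 u * m2 u) (k1 * k2).
Proof.
by move=> h1 h2 p M pM x; rewrite tmul_comp -mulrA; apply: h1 => y; exact: h2.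
Qed.

Lemma opboundZ a m k : opbound m k -> opbound (fun u => a%:C%C * m u) (`|a| * k).
Proof.
by move=> h p M pM x; rewrite tpoly_tmulZ normrM -mulrA ler_wpM2l//; exact: h.
Qed.

Lemma opbound1 : opbound (fun=> 1) 1.
Proof. by move=> p M pM x; rewrite tpoly_tmul1 mul1r. Qed.

Lemma opbound_cst a : opbound (fun=> a%:C%C) `|a|.
Proof.
have := opboundZ a _ _ opbound1; rewrite [X in opbound _ X]mulr1; apply: eq_opbound => u.
by rewrite mulr1.
Qed.

Lemma opbound_wave h : opbound (wave ^~ h) 1.
Proof. by move=> p M pM x; rewrite tpoly_tmul_wave mul1r. Qed.

Lemma opboundX m n : opbound m 1 -> opbound (fun u => m u ^+ n) 1.
Proof.
move=> h; elim: n => [|n IH].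
  by apply: eq_opbound opbound1 => u; rewrite expr0.
rewrite -[1 : R](mulr1 1); apply: eq_opbound (opboundM _ _ _ _ h IH) => u.
by rewrite exprS.
Qed.

Lemma opboundW m k k' : opbound m k -> k <= k' -> opbound m k'.
Proof.
move=> h kk' p M pM x; apply: (le_trans (h _ _ pM x)).
by rewrite ler_wpM2r//; apply: le_trans (pM 0).
Qed.

(** A fixed polynomial has finitely many frequencies, so convergence at each frequency suffices,
    without uniformity. *)
Lemma opbound_lim (ms : nat -> V -> R[i]) m k :
  (forall u, ccvg (ms ^~ u) (m u)) -> (\forall n \near \oo, opbound (ms n) k) ->
  opbound m k.
Proof.
move=> mm mk p M pM x.
have h : tpoly (tmul (ms n) p) x @[n --> \oo] --> tpoly (tmul m p) x.
  under eq_fun do rewrite tpoly_tmul.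
  rewrite tpoly_tmul; apply: cvg_big => [|c _]; first exact: add_continuous.
  by have [] := ccvgM _ _ _ _ (ccvgM _ _ _ _ (mm c.2) (ccvg_cst c.1))
    (ccvg_cst (wave c.2 x)).
have hn : `|tpoly (tmul (ms n) p) x| @[n --> \oo] --> `|tpoly (tmul m p) x|.
  exact: cvg_norm.
rewrite -(cvg_lim _ hn)//; apply: limr_le; first by apply/cvg_ex; eexists; exact: hn.
by apply: filterS mk => n /(_ p M pM x).
Qed.

Lemma opbound_cexp (m : V -> R[i]) :
  (\forall n \near \oo, opbound (fun u => 1 + m u / n.+1%:R) 1) ->
  opbound (fun u => cexp (m u)) 1.
Proof.
move=> h; apply: (@opbound_lim (fun n u => (1 + m u / n.+1%:R) ^+ n.+1)).
  by move=> u; exact: ccvg_euler.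
by apply: filterS h => n; exact: opboundX.
Qed.

Lemma opbound_div_nat (m : V -> R[i]) k n : opbound m k ->
  opbound (fun u => m u / n.+1%:R) (k / n.+1%:R).
Proof.
move=> /(opboundZ n.+1%:R^-1); rewrite ger0_norm ?invr_ge0// mulrC.
apply: eq_opbound => u; rewrite mulrC; congr (_ * _).
by rewrite (fmorphV (real_complex R)) rmorph_nat.
Qed.

(* [v ((1 + w/N)^n - 1)] is estimated by induction on [n]; then n = N tends
   to infinity. *)
Lemma opbound_mul_cexpB1 (v w : V -> R[i]) a k : 0 <= a -> 0 <= k ->
  opbound w a -> opbound (fun u => v u * w u) (k * a) ->
  opbound (fun u => v u * (cexp (w u) - 1)) (k * expR a).
Proof.
move=> a0 k0 wa vw.
apply: (@opbound_lim (fun n u => v u * ((1 + w u / n.+1%:R) ^+ n.+1 - 1))).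
  move=> u; apply: ccvgM; first exact: ccvg_cst.
  by apply: ccvgD; [exact: ccvg_euler|exact: ccvg_cst].
apply: nearW => N; pose b := a / N.+1%:R.
have b0 : 0 <= b by rewrite divr_ge0.
(* With q = 1 + w/N, v (q^(n+1) - 1) = q v (q^n - 1) + v w / N: each step multiplies the bound by 1
   + b and adds k b. *)
have h n : opbound (fun u => v u * ((1 + w u / N.+1%:R) ^+ n - 1))
    (k * ((1 + b) ^+ n - 1)).
  elim: n => [|n IH].
    rewrite expr0 subrr mulr0.
    have := opbound_cst 0; rewrite normr0; apply: eq_opbound => u.
    by rewrite expr0 subrr mulr0.
  have -> : k * ((1 + b) ^+ n.+1 - 1) =
      (1 + b) * (k * ((1 + b) ^+ n - 1)) + k * a / N.+1%:R.
    by rewrite exprS /b; ring.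
  have := opboundD _ _ _ _
    (opboundM _ _ _ _ (opboundD _ _ _ _ opbound1 (opbound_div_nat _ _ N wa)) IH)
    (opbound_div_nat _ _ N vw).
  by apply: eq_opbound => u /=; rewrite exprS; ring.
apply: (opboundW _ _ _ (h N.+1)); rewrite ler_wpM2l// lerBlDr.
rewrite (@le_trans _ _ (expR a))// ?lerDl//.
have -> : expR a = expR b ^+ N.+1.
  by rewrite -expRM_natr /b divfK// pnatr_eq0.
by rewrite lerXn2r ?nnegrE ?addr_ge0 ?expR_ge0// expR_ge1Dx.
Qed.

End Fourier_multipliers.

(** * Fourier transforms of finite measures *)

Section Rintegral_complements.
Context d {T : measurableType d} {R : realType}.
Variable mu : {measure set T -> \bar R}.
Implicit Types f g : T -> R.

Lemma dominated_Rintegrable f g : measurable_fun setT f ->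
  mu.-integrable setT (EFin \o g) -> (forall x, `|f x| <= g x) ->
  mu.-integrable setT (EFin \o f).
Proof.
move=> mf ig fg; apply: (le_integrable measurableT _ _ ig).
  exact/measurable_EFinP.
by move=> x _; rewrite lee_fin (le_trans (fg x))// ler_norm.
Qed.

Lemma dominated_Rintegral_cvg (fs : nat -> T -> R) f g :
  (forall n, measurable_fun setT (fs n)) -> measurable_fun setT f ->
  mu.-integrable setT (EFin \o g) ->
  (forall x, fs n x @[n --> \oo] --> f x) ->
  (forall n x, `|fs n x| <= g x) ->
  \int[mu]_x fs n x @[n --> \oo] --> \int[mu]_x f x.
Proof.
move=> mfs mf ig fsf fsg.
have [ |||||_ _ /=] := @dominated_convergence _ _ _ mu _ measurableT
    (fun n => EFin \o fs n) (EFin \o f) (EFin \o g).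
- by move=> n; exact/measurable_EFinP.
- exact/measurable_EFinP.
- by apply: aeW => x _; apply: cvg_EFin; [exact: nearW|exact: fsf].
- by [].
- by apply: aeW => x n _; rewrite lee_fin.
move=> h; apply: fine_cvg.
rewrite fineK//; apply: integrable_fin_num => //.
apply: (dominated_Rintegrable _ g) => // x.
rewrite -(cvg_lim _ (cvg_norm (fsf x)))//; apply: limr_le.
  by apply/cvg_ex; eexists; exact: (cvg_norm (fsf x)).
by apply: nearW => n; exact: fsg.
Qed.

End Rintegral_complements.

Section measurability_rV.
Context {R : realType} {d : nat}.
Local Notation V := 'rV[R]_d.

Lemma measurable_dotr (u : V) : measurable_fun [set: V] (dotr u).
Proof.
apply: measurable_sum => i; apply: measurable_funM; first exact: measurable_cst.
exact: measurable_coord.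
Qed.

Lemma measurable_enorm : measurable_fun [set: V] enorm.
Proof.
apply: (measurableT_comp (continuous_measurable_fun (@sqrt_continuous R))).
by apply: measurable_sum => i; apply: measurable_funM; exact: measurable_coord.
Qed.

Lemma measurable_translation (x : V) : measurable_fun [set: V] (fun y => x + y).
Proof.
apply: measurable_fun_rV => i; under eq_fun do rewrite mxE.
by apply: measurable_funD; [exact: measurable_cst|exact: measurable_coord].
Qed.

Lemma measurable_scaling (a : R) : measurable_fun [set: V] (fun y => a *: y).
Proof.
apply: measurable_fun_rV => i; under eq_fun do rewrite mxE.
by apply: measurable_funM; [exact: measurable_cst|exact: measurable_coord].
Qed.

Lemma measurable_Re_wave (u : V) :
  measurable_fun setT (fun x => complex.Re (wave u x)).
Proof.
under eq_fun do rewrite Re_wave.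
exact: (measurableT_comp (continuous_measurable_fun (@continuous_cos R)) (measurable_dotr u)).
Qed.

Lemma measurable_Im_wave (u : V) :
  measurable_fun setT (fun x => complex.Im (wave u x)).
Proof.
under eq_fun do rewrite Im_wave.
exact: (measurableT_comp (continuous_measurable_fun (@continuous_sin R)) (measurable_dotr u)).
Qed.

Lemma measurable_tpoly (p : seq (R[i] * V)) : measurable_fun setT (tpoly p).
Proof.
apply: measurable_sum => c; under eq_fun do rewrite ReM.
apply: measurable_funB; apply: measurable_funM; try exact: measurable_cst.
  exact: measurable_Re_wave.
exact: measurable_Im_wave.
Qed.

Lemma normc_wave (u x : V) : normc (wave u x) = 1.
Proof. by rewrite normc_cexp/= expR0. Qed.

Lemma tpoly_bounded (p : seq (R[i] * V)) x : `|tpoly p x| <= \sum_(c <- p) normc c.1.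
Proof.
rewrite (le_trans (ler_norm_sum _ _ _))//; apply: ler_sum => c _.
by rewrite (le_trans (le_Re_normc _))// Normc.normcM normc_wave mulr1.
Qed.

End measurability_rV.

Section Fourier_transform.
Context {R : realType} {d : nat} {dT : measure_display}.
Context {T : measurableType dT}.
Variables (mu : {measure set T -> \bar R}) (w : T -> R) (X : T -> 'rV[R]_d).
Hypotheses (mw : measurable_fun setT w) (iw : mu.-integrable setT (EFin \o w)).
Hypothesis mX : measurable_fun setT X.

(** Fourier transform of the image under [X] of the signed measure with density [w]. One notion
    covers the law of a random vector, the truncated Levy measure and the weighted cube. *)
Definition wft (u : 'rV[R]_d) : R[i] :=
  cintegral mu (fun y => (w y)%:C%C * wave u (X y)).

Lemma integrable_weighted (f : 'rV[R]_d -> R) (k : R) :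
  measurable_fun setT f -> (forall x, `|f x| <= k) ->
  mu.-integrable setT (EFin \o (fun y => w y * f (X y))).
Proof.
move=> mf fk; apply: (dominated_Rintegrable _ _ _ (fun y => k * `|w y|)) => //.
- by apply: measurable_funM => //; exact: measurableT_comp.
- have := integrable_norm iw => /(integrableZl measurableT k).
  by apply: eq_integrable => //= y _; rewrite EFinM.
- by move=> y; rewrite normrM mulrC ler_wpM2r.
Qed.

Lemma Re_wft u : complex.Re (wft u) = \int[mu]_y (w y * complex.Re (wave u (X y))).
Proof.
by rewrite /wft /=; congr fine; apply: eq_integral => y _ /=; rewrite mul0r subr0.
Qed.

Lemma Im_wft u : complex.Im (wft u) = \int[mu]_y (w y * complex.Im (wave u (X y))).
Proof.
by rewrite /wft /=; congr fine; apply: eq_integral => y _ /=; rewrite mul0r addr0.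
Qed.

Lemma integrable_weighted_Re u :
  mu.-integrable setT (EFin \o (fun y => w y * complex.Re (wave u (X y)))).
Proof.
apply: (integrable_weighted (fun x => complex.Re (wave u x)) 1).
  exact: measurable_Re_wave.
by move=> x; rewrite Re_wave cos_max.
Qed.

Lemma integrable_weighted_Im u :
  mu.-integrable setT (EFin \o (fun y => w y * complex.Im (wave u (X y)))).
Proof.
apply: (integrable_weighted (fun x => complex.Im (wave u x)) 1).
  exact: measurable_Im_wave.
by move=> x; rewrite Im_wave sin_max.
Qed.

Lemma integrable_weighted_tpoly p x :
  mu.-integrable setT (EFin \o (fun y => w y * tpoly p (x + X y))).
Proof.
apply: (integrable_weighted (fun y => tpoly p (x + y)) (\sum_(c <- p) normc c.1)).
  by apply: measurableT_comp; [exact: measurable_tpoly|exact: measurable_translation].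
by move=> y; exact: tpoly_bounded.
Qed.

(** The multiplier is an average of translates, which is why the total variation of the measure
    bounds its norm. *)
Lemma tpoly_tmul_wft p x :
  tpoly (tmul wft p) x = \int[mu]_y (w y * tpoly p (x + X y)).
Proof.
elim: p => [|c p IH].
  rewrite /tpoly big_nil; apply/esym.
  under eq_Rintegral do rewrite /tpoly big_nil mulr0.
  by rewrite Rintegral_cst// mul0r.
transitivity (complex.Re (wft c.2 * (c.1 * wave c.2 x)) + tpoly (tmul wft p) x).
  by rewrite {1}/tpoly /= big_cons/= mulrA.
rewrite ReM Re_wft Im_wft IH.
set z := c.1 * _.
rewrite -!RintegralZr//; [|exact: integrable_weighted_Im|exact: integrable_weighted_Re].
have iA : mu.-integrable setT
    (EFin \o (fun y => w y * complex.Re (wave c.2 (X y)) * complex.Re z)).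
  have := integrable_weighted_Re c.2 => /(integrableZr measurableT (complex.Re z)).
  by apply: eq_integrable => //= y _; rewrite EFinM.
have iB : mu.-integrable setT
    (EFin \o (fun y => w y * complex.Im (wave c.2 (X y)) * complex.Im z)).
  have := integrable_weighted_Im c.2 => /(integrableZr measurableT (complex.Im z)).
  by apply: eq_integrable => //= y _; rewrite EFinM.
rewrite -RintegralB// -RintegralD//; last 2 first.
- have := integrableB measurableT iA iB.
  by apply: eq_integrable => //= y _; rewrite EFinB.
- exact: integrable_weighted_tpoly.
apply: eq_Rintegral => y _.
rewrite {2}/tpoly big_cons -/(tpoly p (x + X y)) mulrDr; congr (_ + _).
by rewrite waveDr mulrA -/z ReM; ring.
Qed.

Lemma opbound_wft : opbound wft (\int[mu]_y `|w y|).
Proof.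
move=> p M pM x; rewrite tpoly_tmul_wft.
have i1 := integrable_weighted_tpoly p x.
rewrite (le_trans (le_normr_Rintegral measurableT i1))//.
rewrite -RintegralZr//; last exact: integrable_norm.
apply: le_Rintegral => //; first exact: integrable_norm.
  have := integrable_norm iw => /(integrableZr measurableT M).
  by apply: eq_integrable => //= y _; rewrite EFinM.
by move=> y _; rewrite normrM ler_wpM2l.
Qed.

(** The averaging formula for one-term polynomials: coefficient 1 gives the real part, coefficient
    -i the imaginary part, since Re (-i z) = Im z. *)
Lemma wave_mul_wft u h : wave u h * wft u =
  cintegral mu (fun y => (w y)%:C%C * wave u (h + X y)).
Proof.
apply: complex_eqP.
  have := tpoly_tmul_wft [:: (1, u)] h.
  rewrite tpoly_tmul big_seq1 -[(1, u).1]/(1 : R[i]) -[(1, u).2]/u mulr1.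
  rewrite (mulrC (wft u)) => ->; congr fine.
  by apply: eq_integral => y _; rewrite /tpoly big_seq1/= !mul0r !mul1r !subr0.
have := tpoly_tmul_wft [:: ((0 -i* 1)%C, u)] h.
rewrite tpoly_tmul big_seq1 -mulrA ReM.
set z := wft u; set v := wave u h => e.
have -> : complex.Im (v * z) =
    complex.Re z * complex.Re ((0 -i* 1)%C * v) - complex.Im z * complex.Im ((0 -i* 1)%C * v).
  by rewrite !ReImE/=; ring.
rewrite e; congr fine.
by apply: eq_integral => y _; rewrite /tpoly big_seq1 !ReImE/=; congr (_%:E); ring.
Qed.

End Fourier_transform.

Lemma wftB (R : realType) d dT (T : measurableType dT) (mu : {measure set T -> \bar R})
    (w1 w2 : T -> R) (X : T -> 'rV[R]_d) u :
  measurable_fun setT w1 -> mu.-integrable setT (EFin \o w1) ->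
  measurable_fun setT w2 -> mu.-integrable setT (EFin \o w2) ->
  measurable_fun setT X ->
  wft mu (fun y => w1 y - w2 y) X u = wft mu w1 X u - wft mu w2 X u.
Proof.
move=> mw1 iw1 mw2 iw2 mX; apply: complex_eqP.
  rewrite ReD ReN !Re_wft -RintegralB//; try exact: integrable_weighted_Re.
  by apply: eq_Rintegral => y _; rewrite -mulrBl.
rewrite ImD ImN !Im_wft -RintegralB//; try exact: integrable_weighted_Im.
by apply: eq_Rintegral => y _; rewrite -mulrBl.
Qed.

(** * The uniform law on a cube and its translates *)

Section measure_comparison.
Local Open Scope ereal_scope.
Context {d : measure_display} {T : measurableType d} {R : realType}.
Import HBNNSimple.

(** The integral is a supremum over nonnegative simple functions below the extension of [f] by 0.
    Such a function vanishes outside [D], so its level sets with nonzero value lie in [D], where the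
    measures are comparable. *)
Lemma ge0_le_measure_integral_in (m1 m2 : {measure set T -> \bar R})
    (D : set T) (f : T -> \bar R) : measurable D ->
  (forall S, measurable S -> S `<=` D -> m1 S <= m2 S) ->
  (forall x, D x -> 0 <= f x) ->
  \int[m1]_(x in D) f x <= \int[m2]_(x in D) f x.
Proof.
move=> mD m12 f0; rewrite !ge0_integralE //= ge_ereal_sup// => _ [h/= hfS] <-.
apply: le_ereal_sup_tmp; exists (sintegral m2 h); first by exists h.
rewrite !sintegralE lee_fsum// => r [t _ htr].
have [->|r0] := eqVneq r 0%R; first by rewrite !mul0e.
subst r; rewrite lee_pmul ?lee_fin// m12// => x /= hx.
apply: contrapT => Dx; move/eqP: r0; apply; rewrite -hx.
have := hfS x; rewrite patchE memNset// lee_fin => hx0.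
by apply/eqP; rewrite eq_le hx0/=.
Qed.

End measure_comparison.

Section Lebesgue_translation.
Context {R : realType} {d : nat}.
Local Notation V := 'rV[R]_d.
Local Notation leb := (lebesgue_rV d : {measure set V -> \bar R}).

Definition rV_box (A : 'I_d -> set R) : set V := [set x | forall i, A i (x 0 i)].

Lemma measurable_rV_box (A : 'I_d -> set R) : (forall i, measurable (A i)) ->
  measurable (rV_box A).
Proof.
move=> mA; rewrite [X in measurable X](_ : _ = \bigcap_(i in [set: 'I_d])
    (fun x : V => x 0 i) @^-1` A i).
  apply: fin_bigcap_measurable => // i _.
  by rewrite -[X in measurable X]setTI; exact: measurable_coord.
by apply/seteqP; split => x /= h i; [move=> _; exact: h|exact: (h i I)].
Qed.

(** For the harder inclusion, the identity defined on the space with the sigma-algebra generated by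
    boxes is measurable because its coordinates are. *)
Lemma measurable_rV_boxE : @measurable _ V =
  <<s [set B | exists2 A, (forall i, measurable (A i)) & B = rV_box A] >>.
Proof.
set G := [set B | _].
have mid : measurable_fun [set: g_sigma_algebraType G] (id : _ -> V).
  apply: measurable_fun_rV => i _ B mB; rewrite setTI.
  apply: sub_sigma_algebra; exists (fun j => if j == i then B else setT).
    by move=> j; case: ifP.
  apply/seteqP; split => x /=; last by move=> /(_ i); rewrite eqxx.
  by move=> Bx j; case: eqP => // ->.
apply/seteqP; split => [B mB|].
  by have := mid measurableT B mB; rewrite setTI.
apply: smallest_sub; first exact: sigma_algebra_measurable.
by move=> _ [A mA ->]; exact: measurable_rV_box.
Qed.

Lemma lebesgue_measure_translation (a : R) (A : set R) : measurable A ->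
  pushforward (@lebesgue_measure R) ((fun x => a + x) : _ -> measurableTypeR R) A
  = lebesgue_measure A.
Proof.
move=> mA; apply/esym/lebesgue_measure_unique => //=.
  by apply: measurable_funD.
move=> mt _ [[p q]] _ <-; rewrite /pushforward.
rewrite (_ : _ @^-1` _ = `]p - a, q - a]%classic); last first.
  apply/seteqP; split => x /=; rewrite !in_itv/= => /andP[h1 h2];
    apply/andP; split; lra.
rewrite !lebesgue_measure_itv/= !lte_fin ltrD2r -!EFinB.
by case: ifP => // _; congr (_%:E); ring.
Qed.

Lemma lebesgue_rV_boxE (A : 'I_d -> set R) : (forall i, measurable (A i)) ->
  leb (rV_box A) = (\prod_(i < d) lebesgue_measure (A i))%E.
Proof. by move=> mA; exact: (lebesgue_rV_box mA). Qed.

Lemma lebesgue_rV_itv (a b : 'I_d -> R) : (forall i, a i <= b i) ->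
  leb (rV_box (fun i => `[a i, b i]%classic)) =
  (\prod_(i < d) (b i - a i))%:E.
Proof.
move=> ab; rewrite lebesgue_rV_boxE// -prodEFin; apply: eq_bigr => i _.
rewrite lebesgue_measure_itv/= lte_fin lt_neqAle ab andbT.
by case: eqVneq => [->|//]; rewrite subrr.
Qed.

Let cube_cover (k : nat) := rV_box (fun=> `[- k%:R, k%:R]%classic).

(** Both measures agree on boxes, a generating class stable under intersection, and the boxes
    [cube_cover k] of finite measure exhaust the space. *)
Lemma lebesgue_rV_translation (h : V) (A : set V) : measurable A ->
  pushforward leb (fun y => h + y) A = leb A.
Proof.
have mt := measurable_translation h => mA.
have hbox (B : 'I_d -> set R) : (forall i, measurable (B i)) ->
    pushforward leb (fun y => h + y) (rV_box B) = leb (rV_box B).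
  move=> mB; rewrite /pushforward.
  transitivity (leb (rV_box (fun i => (fun z => h 0 i + z) @^-1` B i))).
    by congr (leb _); apply/seteqP; split => y /= hy i; have := hy i; rewrite mxE.
  rewrite !lebesgue_rV_boxE//.
    by apply: eq_bigr => i _; exact: lebesgue_measure_translation.
  move=> i; rewrite -[X in measurable X]setTI.
  by apply: (measurable_funD (measurable_cst (h 0 i)) (@measurable_id _ _ _)).
apply: (measure_unique [set B | exists2 A, (forall i, measurable (A i)) & B = rV_box A]
  cube_cover measurable_rV_boxE) => //.
- move=> _ _ [B mB ->] [C mC ->]; exists (fun i => B i `&` C i).
    by move=> i; exact: measurableI.
  apply/seteqP; split => x /=; first by move=> [h1 h2] i; split.
  by move=> h1; split => i; have [] := h1 i.
- by move=> k; exists (fun=> `[- k%:R, k%:R]%classic).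
- apply/seteqP; split => // x _.
  pose M := \sum_(i < d) `|x 0 i|.
  exists (Num.truncn M).+1 => // i /=; rewrite in_itv/= -ler_norml.
  rewrite ltW// (le_lt_trans _ (truncnS_gt M))// /M (bigD1 i)//= lerDl.
  by apply: sumr_ge0.
- by move=> _ [B mB ->]; exact: hbox.
- move=> k; apply: (@le_lt_trans _ _ (leb (cube_cover k))).
    by rewrite -(hbox (fun=> `[- k%:R, k%:R]%classic)).
  rewrite lebesgue_rV_itv ?ltry// => i.
  by rewrite (@le_trans _ _ 0)// oppr_le0.
Qed.

Lemma Rintegral_translation (h : V) (f : V -> R) : measurable_fun setT f ->
  leb.-integrable setT (EFin \o f) ->
  \int[leb]_y f (h + y) = \int[leb]_y f y.
Proof.
have mt := measurable_translation h => mf /integrableP[_ intf].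
have mEf : measurable_fun setT (EFin \o f) by exact/measurable_EFinP.
pose phi (y : V) := h + y.
have eqi (g : V -> \bar R) :
    (\int[pushforward leb phi]_y g y = \int[leb]_y g y)%E.
  by apply: eq_measure_integral => A mA _; exact: lebesgue_rV_translation.
congr fine.
rewrite -[RHS]eqi (@integral_pushforward _ _ _ _ _ _ mt leb setT)//.
apply/integrableP; split; first exact: (measurableT_comp mEf mt).
apply: le_lt_trans intf.
rewrite -[leRHS]eqi (@ge0_integral_pushforward _ _ _ _ _ _ mt leb setT)//.
exact: measurableT_comp.
Qed.

End Lebesgue_translation.

Lemma bernoulli_le (R : realFieldType) (x : R) n : 0 <= x -> x <= 1 ->
  1 - n%:R * x <= (1 - x) ^+ n.
Proof.
move=> x0 x1; elim: n => [|n IH]; first by rewrite mul0r subr0 expr0.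
rewrite exprS -natr1.
have nx0 : 0 <= n%:R * x * x :> R by rewrite !mulr_ge0.
apply: (@le_trans _ _ ((1 - x) * (1 - n%:R * x))); first lra.
by rewrite ler_wpM2l// subr_ge0.
Qed.

Section uniform_cube.
Context {R : realType} {d : nat}.
Local Notation V := 'rV[R]_d.
Local Notation leb := (lebesgue_rV d : {measure set V -> \bar R}).
Implicit Types (s k : R) (h u : V).

(* Away from the origin, hence inside every far enough truncation of nu. *)
Definition cube s : set V := rV_box (fun=> `[s, s *+ 2]%classic).

Lemma measurable_cube s : measurable (cube s).
Proof. by apply: measurable_rV_box => i; exact: measurable_itv. Qed.

Lemma lebesgue_cube s : 0 <= s -> leb (cube s) = (s ^+ d)%:E.
Proof.
move=> s0; rewrite /cube lebesgue_rV_itv; last by move=> i; rewrite mulr2n lerDl.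
by rewrite (eq_bigr (fun=> s)) ?prodr_const ?card_ord// => i _; rewrite mulr2n addrK.
Qed.

Definition cube_weight k s (y : V) : R := k * \1_(cube s) y.

Lemma measurable_cube_weight k s : measurable_fun setT (cube_weight k s).
Proof.
apply: measurable_funM; first exact: measurable_cst.
apply: measurable_indic; exact: measurable_cube.
Qed.

Lemma integrable_indic_fin (A : set V) : measurable A -> (leb A < +oo)%E ->
  leb.-integrable setT (EFin \o (\1_A : V -> R)).
Proof.
move=> mA Afin; apply/integrableP; split; first exact/measurable_EFinP.
under eq_integral do rewrite /= ger0_norm//.
by rewrite integral_indic// setIT.
Qed.

Lemma Rintegral_indic (A : set V) : measurable A ->
  \int[leb]_y \1_A y = fine (leb A).
Proof. by move=> mA; rewrite /Rintegral integral_indic// setIT. Qed.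

Lemma integrable_cube_weight k s : 0 <= s ->
  leb.-integrable setT (EFin \o cube_weight k s).
Proof.
move=> s0; have /(integrableZl measurableT k) :
    leb.-integrable setT (EFin \o (\1_(cube s) : V -> R)).
  apply: integrable_indic_fin; first exact: measurable_cube.
  by rewrite lebesgue_cube// ltry.
by apply: eq_integrable => //= y _; rewrite EFinM.
Qed.

Lemma Rintegral_cube_weight k s : 0 <= s -> \int[leb]_y cube_weight k s y = k * s ^+ d.
Proof.
move=> s0; rewrite RintegralZl//; last first.
  apply: integrable_indic_fin; first exact: measurable_cube.
  by rewrite lebesgue_cube// ltry.
by rewrite Rintegral_indic ?lebesgue_cube//; exact: measurable_cube.
Qed.

(* A cube of side [s - enorm h] lies in both the cube and its translate. *)
Lemma cube_translate_dist k s h : 0 <= k -> enorm h <= s -> 0 < s ->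
  \int[leb]_y `|cube_weight k s y - cube_weight k s (- h + y)| <=
  k * s ^+ d * (2 * d%:R * enorm h / s).
Proof.
move=> k0 hs s0; set e := enorm h.
have e0 : 0 <= e := enorm_ge0 h.
pose B := (fun y : V => - h + y) @^-1` cube s.
have mB : measurable B.
  rewrite -[X in measurable X]setTI; apply: measurable_translation => //.
  exact: measurable_cube.
have lB : leb B = (s ^+ d)%:E.
  by rewrite -(lebesgue_cube _ (ltW s0)) -(lebesgue_rV_translation (- h) (cube s))//; exact: measurable_cube.
(* The larger of the two lower ends [s] and [s + h 0 i]; an interval of length [s - e] from there
   stays below both upper ends because [|h 0 i| <= e]. *)
pose a (i : 'I_d) := s + Num.max 0 (h 0 i).
pose A := rV_box (fun i => `[a i, a i + (s - e)]%classic).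
have mA : measurable A by apply: measurable_rV_box => i; exact: measurable_itv.
have lA : leb A = ((s - e) ^+ d)%:E.
  rewrite lebesgue_rV_itv; last by move=> i; rewrite lerDl subr_ge0.
  by rewrite (eq_bigr (fun=> s - e)) ?prodr_const ?card_ord// => i _; rewrite addrC addKr.
have AC : A `<=` cube s `&` B.
  move=> y Ay; split => i /=; have := Ay i; rewrite /= !in_itv/= ?mxE /a mulr2n
    => /andP[h1 h2]; have := norm_coord_le_enorm h i; rewrite -/e ler_norml
    => /andP[h3 h4]; move: h1 h2; rewrite maxEle; case: ifP => h5 h1 h2;
    apply/andP; split; lra.
have iC : leb.-integrable setT (EFin \o (\1_(cube s) : V -> R)).
  apply: integrable_indic_fin; first exact: measurable_cube.
  by rewrite lebesgue_cube ?ltry// ltW.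
have iB : leb.-integrable setT (EFin \o (\1_B : V -> R)).
  by apply: integrable_indic_fin => //; rewrite lB ltry.
have iA : leb.-integrable setT (EFin \o (\1_A : V -> R)).
  by apply: integrable_indic_fin => //; rewrite lA ltry.
(* [D] dominates the indicator of the symmetric difference, and its integral 2 s^d - 2 (s - e)^d is
   estimated by Bernoulli's inequality. *)
pose D (y : V) : R := \1_(cube s) y + \1_B y - 2 * \1_A y.
have iBC : leb.-integrable setT (EFin \o (fun y => \1_(cube s) y + \1_B y : R)).
  have := integrableD measurableT iC iB.
  by apply: eq_integrable => //= y _; rewrite EFinD.
have i2A : leb.-integrable setT (EFin \o (fun y => 2 * \1_A y : R)).
  have := integrableZl measurableT 2 iA.
  by apply: eq_integrable => //= y _; rewrite EFinM.
have iD : leb.-integrable setT (EFin \o D).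
  have := integrableB measurableT iBC i2A.
  by apply: eq_integrable => //= y _; rewrite EFinB.
have ikD : leb.-integrable setT (EFin \o (fun y => k * D y)).
  have := integrableZl measurableT k iD.
  by apply: eq_integrable => //= y _; rewrite EFinM.
have dist y : `|cube_weight k s y - cube_weight k s (- h + y)| <= k * D y.
  rewrite /cube_weight -mulrBr normrM (ger0_norm k0) ler_wpM2l//.
  have -> : \1_(cube s) (- h + y) = \1_B y :> R by [].
  rewrite /D !indicE.
  have [yA|yA] := boolP (y \in A).
    have /AC[yC yB] := set_mem yA.
    by rewrite (mem_set yC) (mem_set yB) subrr normr0/=; lra.
  rewrite mulr0 subr0 (le_trans (ler_normB _ _))//.
  by rewrite !ger0_norm.
have iN : leb.-integrable setT (EFin \o
    (fun y => `|cube_weight k s y - cube_weight k s (- h + y)|)).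
  apply: (dominated_Rintegrable _ _ _ (fun y => k * D y)) => //.
    apply: measurableT_comp => //; apply: measurable_funB.
      exact: measurable_cube_weight.
    exact: (measurableT_comp (measurable_cube_weight k s) (measurable_translation (- h))).
  by move=> y; rewrite normr_id.
apply: (le_trans (le_Rintegral measurableT iN ikD (fun y _ => dist y))).
rewrite RintegralZl// RintegralB// RintegralD// RintegralZl// !Rintegral_indic//; last exact: measurable_cube.
rewrite lA lB lebesgue_cube ?(ltW s0)//= -mulrA ler_wpM2l//.
have es : e / s <= 1 by rewrite ler_pdivrMr// mul1r.
have bern := bernoulli_le _ _ d (divr_ge0 e0 (ltW s0)) es.
have -> : (s - e) ^+ d = s ^+ d * (1 - e / s) ^+ d.
  by rewrite -exprMn mulrBr mulr1 mulrC divfK// gt_eqF.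
have sd0 : 0 <= s ^+ d by rewrite exprn_ge0// ltW.
apply: (@le_trans _ _ (s ^+ d * (2 - 2 * (1 - d%:R * (e / s))))); last first.
  by rewrite le_eqVlt; apply/orP; left; apply/eqP; field; rewrite gt_eqF.
have := ler_wpM2l sd0 bern; lra.
Qed.

(** Multiplication by a wave translates the measure, so this multiplier is the transform of the cube
    weight minus its translate, and its norm is at most their L1 distance. *)
Lemma opbound_cube_translate k s h : 0 <= k -> enorm h <= s -> 0 < s ->
  opbound (fun u => (1 - wave u h) * wft leb (cube_weight k s) id u)
    (k * s ^+ d * (2 * d%:R * enorm h / s)).
Proof.
move=> k0 hs s0.
have mw := measurable_cube_weight k s.
have iw := integrable_cube_weight k _ (ltW s0).
have mt := measurable_translation (- h).
pose w' y := cube_weight k s y - cube_weight k s (- h + y).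
have mw2 : measurable_fun setT (fun y => cube_weight k s (- h + y)).
  exact: (measurableT_comp mw mt).
have iw2 : leb.-integrable setT (EFin \o (fun y => cube_weight k s (- h + y))).
  have : leb.-integrable setT (EFin \o (fun y => k * \1_((fun y => - h + y) @^-1` cube s) y)).
    have mB : measurable ((fun y : V => - h + y) @^-1` cube s).
      rewrite -[X in measurable X]setTI; apply: measurable_translation => //.
      exact: measurable_cube.
    have lB : leb ((fun y : V => - h + y) @^-1` cube s) = (s ^+ d)%:E.
      by rewrite -(lebesgue_cube _ (ltW s0)) -(lebesgue_rV_translation (- h) (cube s))//; exact: measurable_cube.
    have := integrable_indic_fin _ mB; rewrite lB ltry.
    move=> /(_ erefl)/(integrableZl measurableT k).
    by apply: eq_integrable => //= y _; rewrite EFinM.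
  by apply: eq_integrable.
have mw' : measurable_fun setT w' by exact: measurable_funB.
have iw' : leb.-integrable setT (EFin \o w').
  have := integrableB measurableT iw iw2.
  by apply: eq_integrable => //= y _; rewrite EFinB.
have := opbound_wft leb w' id mw' iw' (@measurable_id _ _ _).
move=> /opboundW /(_ (cube_translate_dist _ _ _ k0 hs s0)).
apply: eq_opbound => u.
have tr (f : V -> R) : measurable_fun setT f -> (forall x, `|f x| <= 1) ->
    \int[leb]_y (cube_weight k s y * f (h + y)) =
    \int[leb]_y (cube_weight k s (- h + y) * f y).
  move=> mf f1; rewrite -(Rintegral_translation h (fun y => cube_weight k s (- h + y) * f y)).
  - by apply: eq_Rintegral => y _; rewrite addKr.
  - by apply: measurable_funM.
  - by have := integrable_weighted leb _ id mw2 iw2 (@measurable_id _ _ _) f 1 mf f1.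
have bcos y : `|complex.Re (wave u y)| <= 1 by rewrite Re_wave cos_max.
have bsin y : `|complex.Im (wave u y)| <= 1 by rewrite Im_wave sin_max.
have mcos := measurable_Re_wave u; have msin := measurable_Im_wave u.
rewrite wftB// mulrBl mul1r; congr (_ - _).
rewrite wave_mul_wft//.
by apply: complex_eqP; rewrite ?Re_wft ?Im_wft -tr//; congr fine;
  apply: eq_integral => y _ /=; rewrite ?mul0r ?subr0 ?addr0.
Qed.

End uniform_cube.

(** * From trigonometric polynomials to Borel functions *)

Section threshold_polynomials.
Context {R : realType}.
Implicit Types t s : R.

(** Decay of powers without division: the left side does not increase with [n]. *)
Lemma exprn_mulD1_le1 t n : 0 <= t -> t <= 1 -> t ^+ n * (1 + n%:R * (1 - t)) <= 1.
Proof.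
move=> t0 t1; elim: n => [|n IH]; first by rewrite mul0r addr0 mulr1.
apply: le_trans IH; rewrite exprSr -mulrA ler_wpM2l ?exprn_ge0// -natr1.
have n0 : 0 <= n%:R * (1 - t) * (1 - t) by rewrite !mulr_ge0// subr_ge0.
have : 0 <= (1 - t) * (1 - t) by rewrite mulr_ge0// subr_ge0.
nra.
Qed.

(** With t = r^2, one factor r^n absorbs n, since n r^n <= 1 / (1 - r), and the other tends to 0. *)
Lemma cvg_natmul_expr t : 0 <= t -> t < 1 -> n%:R * t ^+ n @[n --> \oo] --> 0.
Proof.
move=> t0 t1; pose r := Num.sqrt t.
have r0 : 0 <= r := sqrtr_ge0 t.
have r1 : r < 1 by rewrite -sqrtr1 ltr_sqrt.
have rt : t = r * r by rewrite -expr2 sqr_sqrtr.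
apply: (@squeeze_cvgr _ _ _ _ (fun=> 0) (fun n => (1 - r)^-1 * r ^+ n)).
- apply: nearW => n; rewrite mulr_ge0 ?exprn_ge0//= rt exprMn mulrA.
  rewrite ler_wpM2r ?exprn_ge0// -div1r ler_pdivlMr ?subr_gt0//.
  have := exprn_mulD1_le1 _ n r0 (ltW r1).
  have : 0 <= r ^+ n by exact: exprn_ge0.
  rewrite mulrDr mulr1; lra.
- exact: cvg_cst.
- rewrite -[X in _ --> X](mulr0 (1 - r)^-1); apply: cvgM; first exact: cvg_cst.
  by apply: cvg_expr; rewrite ger0_norm.
Qed.

(** A variant of the polynomials (1 - s^n)^(k^n) from elementary proofs of the Stone-Weierstrass
    theorem. It approximates the indicator of s < 1/2 using only products and complements to 1. *)
Definition threshold_poly n s := (1 - s ^+ n) ^+ (n * 2 ^ n).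

Lemma threshold_poly_itv n s : 0 <= s -> s <= 1 -> 0 <= threshold_poly n s <= 1.
Proof.
move=> s0 s1; have h : 0 <= 1 - s ^+ n by rewrite subr_ge0 exprn_ile1.
by rewrite exprn_ge0//= exprn_ile1// lerBlDr lerDl exprn_ge0.
Qed.

(* The factor [n] in the exponent makes the limit vanish at s = 1/2. *)
Lemma threshold_poly_cvg s : 0 <= s -> s <= 1 ->
  threshold_poly n s @[n --> \oo] --> ((s < 1 / 2)%R%:R : R).
Proof.
move=> s0 s1; have sn0 n : 0 <= s ^+ n by rewrite exprn_ge0.
have sn1 n : s ^+ n <= 1 by rewrite exprn_ile1.
have e n : (n * 2 ^ n)%:R * s ^+ n = n%:R * (2 * s) ^+ n.
  by rewrite natrM natrX exprMn mulrA.
(* Below 1/2, Bernoulli's inequality gives the lower bound 1 - n (2 s)^n. From 1/2 on,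
   [exprn_mulD1_le1] with base 1 - s^n gives the upper bound 1 / (1 + n (2 s)^n) <= 1 / (n + 1). *)
have [s2|s2] := ltP s (1 / 2).
- apply: (@squeeze_cvgr _ _ _ _ (fun n => 1 - n%:R * (2 * s) ^+ n) (fun=> 1)).
  + apply: nearW => n; have /andP[_ ->] := threshold_poly_itv n _ s0 s1.
    by rewrite andbT -e; exact: bernoulli_le.
  + rewrite -[X in _ --> X]subr0; apply: cvgB; first exact: cvg_cst.
    apply: cvg_natmul_expr; first by rewrite mulr_ge0.
    by lra.
  + exact: cvg_cst.
- apply: (@squeeze_cvgr _ _ _ _ (fun=> 0) (fun n => n.+1%:R^-1)).
  + apply: nearW => n; have /andP[-> _] := threshold_poly_itv n _ s0 s1.
    have h0 : 0 <= 1 - s ^+ n by rewrite subr_ge0.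
    have := @exprn_mulD1_le1 (1 - s ^+ n) (n * 2 ^ n) h0 _.
    rewrite lerBlDr lerDl opprB addrCA subrr addr0 e -/(threshold_poly n s) => /(_ (sn0 n)) h.
    rewrite /= -div1r ler_pdivlMr//; apply: le_trans h.
    have /andP[q0 _] := threshold_poly_itv n _ s0 s1.
    rewrite ler_wpM2l// -natr1 addrC lerD2l ler_peMr//.
    by rewrite exprn_ege1//; lra.
  + exact: cvg_cst.
  + exact: cvg_harmonic.
Qed.

End threshold_polynomials.

Section Baire_class.
Context {R : realType} {d : nat}.
Local Notation V := 'rV[R]_d.
Implicit Types (f g : V -> R) (p q : seq (R[i] * V)) (A : set V) (a : R).

Lemma tpoly_cons c p x :
  tpoly (c :: p) x = complex.Re (c.1 * wave c.2 x) + tpoly p x.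
Proof. by rewrite /tpoly big_cons. Qed.

Lemma tpoly_cat p q x : tpoly (p ++ q) x = tpoly p x + tpoly q x.
Proof. by rewrite /tpoly big_cat. Qed.

Definition trig f := exists p, f = tpoly p.

Lemma trig_cst a : trig (fun=> a).
Proof.
exists [:: (a%:C%C, 0)]; apply/funext => x; rewrite /tpoly big_seq1 ReM Re_wave/=.
by rewrite dotr0l cos0 mul0r mulr1 subr0.
Qed.

Lemma trigD f g : trig f -> trig g -> trig (fun x => f x + g x).
Proof.
move=> [p ->] [q ->]; exists (p ++ q); apply/funext => x.
by rewrite tpoly_cat.
Qed.

(* Re z Re w = Re (z w + z conj w) / 2, and the conjugate of a wave is the
   wave of opposite frequency. *)
Lemma trigM f g : trig f -> trig g -> trig (fun x => f x * g x).
Proof.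
move=> [p ->] [q ->].
pose r (c e : R[i] * V) := [:: ((1/2)%:C%C * (c.1 * e.1), c.2 + e.2);
   ((1/2)%:C%C * (c.1 * conjc e.1), c.2 - e.2)].
have rE c e x : tpoly (r c e) x =
    complex.Re (c.1 * wave c.2 x) * complex.Re (e.1 * wave e.2 x).
  rewrite /tpoly big_cons big_seq1 /r; move: c e => [[c1 c2] u] [[e1 e2] v].
  rewrite /wave/= !expR0 dotrDl dotrDl dotrNl cosD sinD cosD sinD cosN sinN.
  by field.
elim: p => [|c p [s sE]].
  exists [::]; apply/funext => x.
  by rewrite /tpoly !big_nil mul0r.
have [t tE] : exists t, (fun x => complex.Re (c.1 * wave c.2 x) * tpoly q x) = tpoly t.
  elim: (q) => [|e q' [t tE]].
    by exists [::]; apply/funext => x; rewrite /tpoly !big_nil mulr0.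
  exists (r c e ++ t); apply/funext => x; have /(congr1 (@^~ x)) /= tx := tE.
  transitivity (tpoly (r c e) x + tpoly t x); last by rewrite -tpoly_cat.
  by rewrite rE -tx tpoly_cons mulrDr.
exists (t ++ s); apply/funext => x.
have /(congr1 (@^~ x)) /= tx := tE; have /(congr1 (@^~ x)) /= sx := sE.
by rewrite tpoly_cat -tx -sx tpoly_cons mulrDl.
Qed.

Lemma trigB f g : trig f -> trig g -> trig (fun x => f x - g x).
Proof.
move=> tf tg; have -> : (fun x => f x - g x) = (fun x => f x + (-1) * g x).
  by apply/funext => x; rewrite mulN1r.
by apply: trigD => //; apply: trigM => //; exact: trig_cst.
Qed.

Lemma trig_sin u a : trig (fun x => sin (dotr u x + a)).
Proof.
exists [:: ((sin a -i* cos a)%C, u)]; apply/funext => x.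
by rewrite /tpoly big_seq1 ReM Re_wave Im_wave/= sinD; ring.
Qed.

(* A bound on a difference of expectations passes to bounded pointwise limits,
   so it extends from trigonometric polynomials to this class, which turns out
   to contain all Borel functions with values in [0, 1]. *)
Inductive baire : (V -> R) -> Prop :=
| baire_trig f : trig f -> (forall x, 0 <= f x <= 1) -> baire f
| baire_lim (fs : nat -> V -> R) f : (forall n, baire (fs n)) ->
    (forall x, fs n x @[n --> \oo] --> f x) -> baire f.

Lemma baire_itv f : baire f -> forall x, 0 <= f x <= 1.
Proof.
elim=> // {}f_ {}f _ IH cvf x; apply/andP; split.
  rewrite -(cvg_lim _ (cvf x))//; apply: limr_ge; first by apply/cvg_ex; exists (f x).
  by apply: nearW => n; have /andP[] := IH n x.
rewrite -(cvg_lim _ (cvf x))//; apply: limr_le; first by apply/cvg_ex; exists (f x).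
by apply: nearW => n; have /andP[] := IH n x.
Qed.

Lemma measurable_baire f : baire f -> measurable_fun setT f.
Proof.
elim=> [{}f [p ->] _|fs {}f _ IH cvf]; first exact: measurable_tpoly.
exact: (measurable_fun_cvg IH (fun x _ => cvf x)).
Qed.

Lemma baireC f : baire f -> baire (fun x => 1 - f x).
Proof.
elim=> [{}f tf f01|fs {}f _ IH cvf].
  apply: baire_trig; first by apply: trigB => //; exact: trig_cst.
  by move=> x; have := f01 x; lra.
by apply: (baire_lim _ _ IH) => x; apply: cvgB; [exact: cvg_cst|exact: cvf].
Qed.

Lemma baireM f g : baire f -> baire g -> baire (fun x => f x * g x).
Proof.
elim=> [{}f tf f01|fs {}f _ IH cvf] bg; last first.
  by apply: (baire_lim _ _ (fun n => IH n bg)) => x; apply: cvgM;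
    [exact: cvf|exact: cvg_cst].
elim: bg => [{}g tg g01|gs {}g _ IH cvg]; last first.
  by apply: (baire_lim _ _ IH) => x; apply: cvgM; [exact: cvg_cst|exact: cvg].
apply: baire_trig; first exact: trigM.
by move=> x; have := f01 x; have := g01 x => /andP[? ?] /andP[? ?];
  rewrite mulr_ge0//= mulr_ile1.
Qed.

(** Convex combinations take the place of sums, which would leave the interval [0, 1]. *)
Lemma baire_conv a f g : 0 <= a <= 1 -> baire f -> baire g ->
  baire (fun x => a * f x + (1 - a) * g x).
Proof.
move=> /andP[a0 a1]; elim=> [{}f tf f01|fs {}f _ IH cvf] bg; last first.
  apply: (baire_lim _ _ (fun n => IH n bg)) => x; apply: cvgD; last exact: cvg_cst.
  by apply: cvgM; [exact: cvg_cst|exact: cvf].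
elim: bg => [{}g tg g01|gs {}g _ IH cvg]; last first.
  apply: (baire_lim _ _ IH) => x; apply: cvgD; first exact: cvg_cst.
  by apply: cvgM; [exact: cvg_cst|exact: cvg].
apply: baire_trig.
  by apply: trigD; apply: trigM => //; exact: trig_cst.
by move=> x; have := f01 x; have := g01 x => /andP[? ?] /andP[? ?]; apply/andP; split; nra.
Qed.

Lemma baire_mean n (gs : nat -> V -> R) : (forall k, baire (gs k)) ->
  baire (fun x => (\sum_(k < n.+1) gs k x) / n.+1%:R).
Proof.
move=> bg; elim: n => [|n IH].
  by under eq_fun do rewrite big_ord1 divr1; exact: bg.
have a01 : 0 <= (n.+2%:R^-1 : R) <= 1 by rewrite invr_ge0 ler0n/= invf_le1// ler1n.
have := baire_conv _ _ _ a01 (bg n.+1) IH.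
congr baire; apply/funext => x; rewrite [in RHS]big_ord_recr/=.
set S := \sum_(k < n.+1) _.
by rewrite -[n.+2%:R]natr1 -[n.+1%:R]natr1; field; rewrite ?natr1 ?pnatr_eq0.
Qed.

(** The source of discontinuous members of the class: powers are products, so every threshold
    polynomial of [f] stays in it. *)
Lemma baire_threshold f : baire f -> baire (fun x => (f x < 1 / 2)%R%:R).
Proof.
move=> bf; have f01 := baire_itv _ bf.
have bX g n : baire g -> baire (fun x => g x ^+ n).
  move=> bg; elim: n => [|n IH].
    under eq_fun do rewrite expr0; apply: baire_trig => [|x]; first exact: trig_cst.
    by rewrite ler01 lexx.
  by under eq_fun do rewrite exprS; exact: baireM.
apply: (baire_lim (fun n x => threshold_poly n (f x))) => [n|x].
  by apply/bX/baireC/bX.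
by have /andP[? ?] := f01 x; exact: threshold_poly_cvg.
Qed.

(** No periodic function has the sign of [x 0 i - a] everywhere, but the sine of
    [(x 0 i - a) / n.+1%:R] has it once the quotient lies in (-1, 1), which for fixed [x] holds for
    all large [n]. *)
Lemma baire_halfspace (i : 'I_d) a : baire (fun x => (x 0 i < a)%R%:R).
Proof.
pose th (n : nat) (x : V) := (x 0 i - a) / n.+1%:R.
have dotE n (x : V) : dotr (n.+1%:R^-1 *: delta_mx 0 i) x - a / n.+1%:R = th n x.
  rewrite /dotr (bigD1 i)//= big1 => [|j ji]; rewrite !mxE ?eqxx/=.
    by rewrite /th; ring.
  by rewrite (negbTE ji) mulr0 mul0r.
apply: (baire_lim (fun n x => (((1 + sin (th n x)) / 2 < 1 / 2)%R%:R : R))) => [n|x].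
  apply: baire_threshold; apply: baire_trig => [|x]; last first.
    by have := sin_geN1 (th n x); have := sin_le1 (th n x) => ? ?; apply/andP; split; lra.
  apply: trigM; last exact: trig_cst.
  apply: trigD; first exact: trig_cst.
  have [p pE] := trig_sin (n.+1%:R^-1 *: delta_mx 0 i) (- (a / n.+1%:R)).
  by exists p; rewrite -pE; apply/funext => x; rewrite dotE.
apply: cvg_near_cst; near=> n; congr (_%:R : R).
have n0 : 0 < n.+1%:R :> R by rewrite ltr0n.
have thx : `|th n x| < 1.
  rewrite normrM normrV ?unitfE ?gt_eqF// (ger0_norm (ltW n0)) ltr_pdivrMr// mul1r.
  rewrite (@le_lt_trans _ _ n%:R) ?ltr_nat//.
  by near: n; exact: nbhs_infty_ger.
have sx : (x 0 i < a) = (th n x < 0).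
  by rewrite /th pmulr_llt0 ?invr_gt0// subr_lt0.
have -> : ((1 + sin (th n x)) / 2 < 1 / 2) = (sin (th n x) < 0).
  by apply/idP/idP; lra.
rewrite sx; move: thx; rewrite ltr_norml => /andP[h1 h2]; have pi2 := pi_ge2 R.
have [h|h|h] := ltgtP (th n x) 0.
- rewrite -oppr_gt0 -sinN sin_gt0_pi//; lra.
- have s0 : 0 < sin (th n x) by apply: sin_gt0_pi; lra.
  by congr nat_of_bool; apply: lt_gtF.
- by rewrite h sin0 ltxx.
Unshelve. all: by end_near. Qed.

(** The sets whose indicator is in the class form a sigma-algebra: complements and products give the
    Boolean operations, limits the countable unions. It contains the half-spaces, so the
    coordinates, and with them the identity, are measurable from it to the Borel sigma-algebra. *)
Lemma baire_indic A : measurable A -> baire (\1_A).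
Proof.
pose S := [set A | baire (\1_A)].
have S0 : S set0.
  rewrite /S/= indic0; apply: baire_trig => [|x]; first exact: trig_cst.
  by rewrite ler01 lexx.
have SC B : S B -> S (~` B).
  by move=> /baireC; rewrite /S/=; congr baire; apply/funext => x;
      rewrite !indicE in_setC; case: (x \in B); rewrite /= ?subrr ?subr0.
have SI B C : S B -> S C -> S (B `&` C).
  by move=> SB SC'; have := baireM _ _ SB SC'; rewrite /S/= indicI.
have SU B C : S B -> S C -> S (B `|` C).
  by move=> /SC SB /SC SC'; rewrite -[_ `|` _]setCK setCU; apply: SC; exact: SI.
have Sbig : forall F : (set V)^nat, (forall i, S (F i)) -> S (\bigcup_i F i).
  move=> F SF; apply: (baire_lim (fun n => \1_(\bigcup_(i < n) F i))) => [n|x].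
    elim: n => [|n IH]; first by rewrite bigcup_mkord big_ord0.
    by rewrite bigcup_mkord big_ord_recr/= -bigcup_mkord; exact: SU.
  apply: cvg_near_cst; rewrite !indicE.
  have [[i _ Fx]|nFx] := pselect ((\bigcup_i F i) x).
    exists i.+1 => // n /= ni; rewrite indicE mem_set ?(mem_set (A := \bigcup_i F i))//; exists i => //.
  by apply: nearW => n; rewrite indicE !memNset// => -[i _ Fx]; apply: nFx; exists i.
have Ssa : sigma_algebra setT S.
  split => //; first by move=> B SB; rewrite setTD; exact: SC.
have SE : @measurable _ (g_sigma_algebraType S) = S by rewrite /measurable/=; exact: sigma_algebra_id.
have mid : measurable_fun [set: g_sigma_algebraType S] (id : _ -> V).
  apply: measurable_fun_rV => i.
  apply: (measurability _ (RGenCInfty.measurableE R)) => _ [_ [a ->] <-].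
  rewrite setTI; apply: sub_sigma_algebra => /=.
  rewrite (_ : _ @^-1` _ = ~` [set x : V | x 0 i < a]).
    apply: SC; have := baire_halfspace i a; rewrite /S/=; congr baire.
    apply/funext => x; rewrite indicE; congr (_%:R : R).
    by congr nat_of_bool; apply/idP/idP => [h|]; [exact: mem_set|rewrite inE].
  by apply/seteqP; split => x /=; rewrite in_itv/= andbT leNgt => /negP.
move=> mA; have := mid measurableT A mA; rewrite setTI.
by rewrite -[X in X (id @^-1` A)]/(@measurable _ (g_sigma_algebraType S)) SE.
Qed.

(** The mean of the indicators of the sets where f >= (k + 1) / (n + 1) rounds [f] down to a
    multiple of 1 / (n + 1). *)
Lemma baire_measurable f : measurable_fun setT f -> (forall x, 0 <= f x <= 1) ->
  baire f.
Proof.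
move=> mf f01.
apply: (baire_lim (fun n x =>
    (\sum_(k < n.+1) (\1_[set y | k.+1%:R / n.+1%:R <= f y] x)) / n.+1%:R)).
  move=> n; apply: (baire_mean n (fun k => \1_[set y | k.+1%:R / n.+1%:R <= f y])) => k.
  apply: baire_indic.
  rewrite (_ : [set y | _] = f @^-1` `[k.+1%:R / n.+1%:R, +oo[%classic).
    by rewrite -[X in measurable X]setTI; exact: mf.
  by apply/seteqP; split => x /=; rewrite in_itv/= andbT.
move=> x; have /andP[f0 f1] := f01 x.
have n0 n : 0 < n.+1%:R :> R by rewrite ltr0n.
have cnt n : (\sum_(k < n.+1) (\1_[set y | k.+1%:R / n.+1%:R <= f y] x : R)) =
    (Num.truncn (f x * n.+1%:R))%:R.
  have sum_minn m N : (\sum_(k < N) ((k < m)%N)%:R)%R = (minn m N)%:R :> R.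
    elim: N => [|N IH]; first by rewrite big_ord0 minn0.
    rewrite big_ord_recr/= IH -natrD; congr (_%:R); lia.
  rewrite (eq_bigr (fun k : 'I_n.+1 => ((k < Num.truncn (f x * n.+1%:R))%N)%:R)).
    rewrite sum_minn (minn_idPl _)// truncn_le_nat.
    by rewrite (@le_lt_trans _ _ n.+1%:R) ?ltr_nat// ler_piMl.
  move=> k _; rewrite indicE truncn_gt_nat -ler_pdivrMr//; congr (_%:R).
  by congr nat_of_bool; apply/idP/idP => [|h]; [rewrite inE|exact: mem_set].
apply: (@squeeze_cvgr _ _ _ _ (fun n => f x - n.+1%:R^-1) (fun=> f x)).
- apply: nearW => n; rewrite cnt ler_pdivlMr// ler_pdivrMr//.
  have y0 : 0 <= f x * n.+1%:R by rewrite mulr_ge0.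
  have /andP[h1 h2] := truncn_itv y0; rewrite h1 andbT.
  by rewrite mulrBl mulVf ?gt_eqF// lerBlDr natr1 ltW.
- rewrite -[X in _ --> X]subr0; apply: cvgB; first exact: cvg_cst.
  exact: cvg_harmonic.
- exact: cvg_cst.
Qed.

End Baire_class.

(** * Removing a finite part of the Levy measure *)

Lemma Rintegral_sum d (T : measurableType d) (R : realType)
    (mu : {measure set T -> \bar R}) (I : Type) (s : seq I) (f : I -> T -> R) :
  (forall i, mu.-integrable setT (EFin \o f i)) ->
  mu.-integrable setT (EFin \o (fun x => \sum_(i <- s) f i x)) /\
  \int[mu]_x (\sum_(i <- s) f i x) = \sum_(i <- s) \int[mu]_x f i x.
Proof.
move=> fi; elim: s => [|i s [IH1 IH2]].
  split; last first.
    rewrite big_nil; under eq_Rintegral do rewrite big_nil.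
    by rewrite Rintegral_cst// mul0r.
  by have := integrable0 mu setT; apply: eq_integrable => // x _; rewrite /= big_nil.
split; last first.
  rewrite big_cons -IH2 -RintegralD//.
  by apply: eq_Rintegral => x _; rewrite big_cons.
have := integrableD measurableT (fi i) IH1.
by apply: eq_integrable => //= x _; rewrite big_cons EFinD.
Qed.

Section characteristic_function.
Context {R : realType} {d : nat} {dO : measure_display}.
Context {Omega : measurableType dO} (P : probability Omega R).
Local Notation V := 'rV[R]_d.
Variable X : Omega -> V.
Hypothesis mX : measurable_fun setT X.

Lemma charfun_wft : charfun P X = wft P (fun=> 1) X.
Proof.
apply/funext => u; rewrite /charfun /wft; congr cintegral.
by apply/funext => w; rewrite mul1r.
Qed.

Let integrable1 : P.-integrable setT (EFin \o (fun=> 1 : R)).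
Proof. exact: finite_measure_integrable_cst. Qed.

Lemma opbound_charfun : opbound (charfun P X) 1.
Proof.
rewrite charfun_wft; apply: opboundW (opbound_wft _ _ _ _ integrable1 mX) _ => //.
rewrite Rintegral_cst// normr1 mul1r.
by rewrite [X in fine X](_ : _ = 1%E)//; exact: probability_setT.
Qed.

Lemma tpoly_tmul_charfun p x :
  tpoly (tmul (charfun P X) p) x = \int[P]_w tpoly p (x + X w).
Proof.
rewrite charfun_wft tpoly_tmul_wft//.
by apply: eq_Rintegral => w _; rewrite mul1r.
Qed.

End characteristic_function.

Lemma charfunZ {R : realType} {d : nat} {dO : measure_display}
    {Omega : measurableType dO} (P : probability Omega R) (X : Omega -> 'rV[R]_d) a u :
  charfun P X (a *: u) = charfun P (fun w => a *: X w) u.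
Proof. by congr cintegral; apply/funext => w; rewrite dotrZl dotrZr. Qed.

Section Levy_exponent.
Context {R : realType} {d : nat}.
Local Notation V := 'rV[R]_d.
Variable nu : {measure set V -> \bar R}.
Hypothesis nu_int : (\int[nu]_y (Num.min 1 (enorm y ^+ 2))%:E < +oo)%E.
Implicit Types (u y : V) (b : V) (A : 'M[R]_d) (n : nat).

Let mn (y : V) : R := Num.min 1 (enorm y ^+ 2).

Let measurable_mn : measurable_fun setT mn.
Proof.
apply: measurable_minr; first exact: measurable_cst.
by apply: measurable_funX; exact: measurable_enorm.
Qed.

Let mn_ge0 y : 0 <= mn y.
Proof. by rewrite le_min ler01 sqr_ge0. Qed.

Let integrable_mn : nu.-integrable setT (EFin \o mn).
Proof.
apply/integrableP; split; first exact/measurable_EFinP.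
by under eq_integral do rewrite /= ger0_norm//.
Qed.

Let integrable_mnZ a : nu.-integrable setT (EFin \o (fun y => a * mn y)).
Proof.
have := integrableZl measurableT a integrable_mn.
by apply: eq_integrable => //= y _; rewrite EFinM.
Qed.

Let small (y : V) : R := (enorm y <= 1)%R%:R.

Let measurable_small : measurable_fun setT small.
Proof.
rewrite (_ : small = \1_(enorm @^-1` `]-oo, 1]%classic)).
  apply: measurable_indic; rewrite -[X in measurable X]setTI.
  exact: measurable_enorm.
apply/funext => y; rewrite indicE; congr (_%:R); congr nat_of_bool.
by apply/idP/idP => [h|]; [apply: mem_set; rewrite /= in_itv|rewrite inE /= in_itv].
Qed.

(** Real and imaginary parts of the integrand of the Levy-Khintchine formula. *)
Definition jump_re u y : R := cos (dotr u y) - 1.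
Definition jump_im u y : R := sin (dotr u y) - dotr u y * (enorm y <= 1)%R%:R.

(** The 2 serves jumps of norm above 1, the square those in the unit ball. Growth at most quadratic
    in [u] makes the bound stable under diffusive rescaling. *)
Definition jump_cst u : R := 2 + (\sum_(i < d) `|u 0 i|) ^+ 2.

Lemma measurable_jump_re u : measurable_fun setT (jump_re u).
Proof.
apply: measurable_funB; last exact: measurable_cst.
exact: (measurableT_comp (continuous_measurable_fun (@continuous_cos R)) (measurable_dotr u)).
Qed.

Lemma measurable_jump_im u : measurable_fun setT (jump_im u).
Proof.
apply: measurable_funB.
  exact: (measurableT_comp (continuous_measurable_fun (@continuous_sin R)) (measurable_dotr u)).
by apply: measurable_funM; [exact: measurable_dotr|exact: measurable_small].
Qed.

Let sqr_dotr_le u y : dotr u y ^+ 2 <= (\sum_(i < d) `|u 0 i|) ^+ 2 * enorm y ^+ 2.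
Proof.
rewrite -exprMn -real_normK ?num_real// lerXn2r ?nnegrE ?norm_dotr_le//.
by rewrite mulr_ge0 ?enorm_ge0// sumr_ge0.
Qed.

Let mn_small y : enorm y <= 1 -> mn y = enorm y ^+ 2.
Proof. by move=> y1; rewrite /mn min_r// exprn_ile1// enorm_ge0. Qed.

Let mn_large y : 1 < enorm y -> mn y = 1.
Proof. by move=> y1; rewrite /mn min_l// exprn_ege1// ltW. Qed.

Lemma jump_re_le u y : `|jump_re u y| <= jump_cst u * Num.min 1 (enorm y ^+ 2).
Proof.
have S0 : 0 <= (\sum_(i < d) `|u 0 i|) ^+ 2 := sqr_ge0 _.
rewrite -/(mn y); have [y1|y1] := leP (enorm y) 1.
  rewrite mn_small// (le_trans (norm_cosB1_le_sqr _))// (le_trans (sqr_dotr_le u y))//.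
  by rewrite ler_wpM2r ?sqr_ge0// lerDr.
rewrite mn_large// mulr1 (le_trans (ler_normB _ _))// normr1.
by have := cos_max (dotr u y); rewrite /jump_cst; lra.
Qed.

Lemma jump_im_le u y : `|jump_im u y| <= jump_cst u * Num.min 1 (enorm y ^+ 2).
Proof.
have S0 : 0 <= (\sum_(i < d) `|u 0 i|) ^+ 2 := sqr_ge0 _.
rewrite -/(mn y) /jump_im; have [y1|y1] := leP (enorm y) 1.
  rewrite mulr1 mn_small// (le_trans (norm_sinBx_le_sqr _))// (le_trans (sqr_dotr_le u y))//.
  by rewrite ler_wpM2r ?sqr_ge0// lerDr.
rewrite mulr0 subr0 mn_large// mulr1.
by have := sin_max (dotr u y); rewrite /jump_cst; lra.
Qed.

Lemma levy_exponentE b A u : levy_exponent b A nu u =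
  ((- (dotr u (u *m A) / 2) + \int[nu]_y jump_re u y) +i*
   (dotr b u + \int[nu]_y jump_im u y))%C.
Proof.
rewrite /levy_exponent /cintegral; apply: complex_eqP => /=.
  rewrite add0r; congr (_ + _); congr fine.
  by apply: eq_integral => y _ /=; rewrite expR0 mul1r oppr0 addr0.
rewrite subr0; congr (_ + _); congr fine.
by apply: eq_integral => y _ /=; rewrite expR0 mul1r oppr0 addr0.
Qed.

(* Diffusive rescaling kills the drift and the jumps, so the Gaussian part is
   a limit of rescaled copies of the process; no square root of A is needed. *)
Lemma levy_exponent_scaling b A u :
  ccvg (fun n => (n.+1%:R ^- 2)%:C%C * levy_exponent b A nu (n.+1%:R *: u))
    (- (dotr u (u *m A) / 2))%:C%C.
Proof.
have n0 n : 0 < n.+1%:R :> R by rewrite ltr0n.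
have nn0 n : n.+1%:R != 0 :> R by rewrite gt_eqF.
have cstn n : n.+1%:R ^- 2 * jump_cst (n.+1%:R *: u) <= jump_cst u.
  rewrite /jump_cst mulrDr.
  have -> : \sum_(i < d) `|(n.+1%:R *: u) 0 i| = n.+1%:R * \sum_(i < d) `|u 0 i|.
    by rewrite mulr_sumr; apply: eq_bigr => i _; rewrite mxE normrM ger0_norm.
  rewrite exprMn mulrA mulVf ?expf_neq0// mul1r lerD2r ler_piMl//.
  by rewrite invf_le1 ?exprn_gt0// exprn_ege1// ler1n.
have harm : n.+1%:R^-1 @[n --> \oo] --> (0 : R) by exact: cvg_harmonic.
have harm2 : n.+1%:R ^- 2 @[n --> \oo] --> (0 : R).
  rewrite (_ : (fun n : nat => _) = (fun n : nat => n.+1%:R^-1 * n.+1%:R^-1 : R)).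
    by rewrite -[in X in _ --> X](mulr0 (0 : R)); exact: cvgM.
  by apply/funext => n; rewrite -invfM -expr2.
have bd n (f : V -> V -> R) : (forall v y, `|f v y| <= jump_cst v * mn y) ->
    forall y, `|n.+1%:R ^- 2 * f (n.+1%:R *: u) y| <= jump_cst u * mn y.
  move=> hf y; rewrite normrM ger0_norm ?invr_ge0 ?exprn_ge0//.
  apply: (le_trans (ler_wpM2l _ (hf _ y))); first by rewrite invr_ge0 exprn_ge0.
  by rewrite mulrA ler_wpM2r.
have intZ n (f : V -> V -> R) : (forall v, measurable_fun setT (f v)) ->
    (forall v y, `|f v y| <= jump_cst v * mn y) ->
    n.+1%:R ^- 2 * (\int[nu]_y f (n.+1%:R *: u) y) =
    \int[nu]_y (n.+1%:R ^- 2 * f (n.+1%:R *: u) y).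
  move=> mf hf; rewrite RintegralZl//.
  by apply: (dominated_Rintegrable _ _ _ _ (mf _) (integrable_mnZ _) (hf _)).
(* Two bounds with different roles: the quadratic one gives a majorant independent of [n], and the
   one linear in [n] forces the pointwise limit 0. *)
have cvg0 (f : V -> V -> R) : (forall v, measurable_fun setT (f v)) ->
    (forall v y, `|f v y| <= jump_cst v * mn y) ->
    (forall n y, `|f (n.+1%:R *: u) y| <= 2 + n.+1%:R * `|dotr u y|) ->
    n.+1%:R ^- 2 * (\int[nu]_y f (n.+1%:R *: u) y) @[n --> \oo] --> (0 : R).
  move=> mf hf hf2; under eq_fun do rewrite intZ//.
  rewrite (_ : 0 = \int[nu]_y (cst 0 y)); last first.
    by rewrite Rintegral_cst// mul0r.
  apply: (dominated_Rintegral_cvg _ _ _ _ (fun y => jump_cst u * mn y)).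
  - by move=> n; apply: measurable_funM; [exact: measurable_cst|exact: mf].
  - exact: measurable_cst.
  - exact: integrable_mnZ.
  - move=> y; apply/norm_cvg0P.
    apply: (@squeeze_cvgr _ _ _ _ (fun=> 0)
      (fun n => n.+1%:R ^- 2 * 2 + n.+1%:R^-1 * `|dotr u y|)).
    + apply: nearW => n; rewrite normr_ge0/= normrM ger0_norm ?invr_ge0 ?exprn_ge0//.
      apply: (le_trans (ler_wpM2l _ (hf2 n y))); first by rewrite invr_ge0 exprn_ge0.
      rewrite mulrDr lerD2l mulrA le_eqVlt; apply/orP; left; apply/eqP.
      by congr (_ * _); field; rewrite addrC natr1.
    + exact: cvg_cst.
    + rewrite (_ : 0 = 0 * 2 + 0 * `|dotr u y|); last by rewrite !mul0r addr0.
      by apply: cvgD; apply: cvgM => //; exact: cvg_cst.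
  - by move=> n; exact: bd.
split.
- have e n : complex.Re ((n.+1%:R ^- 2)%:C%C * levy_exponent b A nu (n.+1%:R *: u)) =
     - (dotr u (u *m A) / 2) + n.+1%:R ^- 2 * (\int[nu]_y jump_re (n.+1%:R *: u) y).
    rewrite levy_exponentE ReM/= mul0r subr0 mulrDr; congr (_ + _).
    rewrite -scalemxAl dotrZl dotrZr; field.
    by rewrite addrC natr1.
  rewrite -[X in _ --> X]addr0; under eq_fun do rewrite e.
  apply: cvgD; first exact: cvg_cst.
  apply: cvg0; [exact: measurable_jump_re|exact: jump_re_le|].
  move=> n y; rewrite (le_trans (ler_normB _ _))// normr1.
  have := cos_max (dotr (n.+1%:R *: u) y).
  have : 0 <= n.+1%:R * `|dotr u y| by rewrite mulr_ge0.
  by lra.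
- have e n : complex.Im ((n.+1%:R ^- 2)%:C%C * levy_exponent b A nu (n.+1%:R *: u)) =
     n.+1%:R^-1 * dotr b u + n.+1%:R ^- 2 * (\int[nu]_y jump_im (n.+1%:R *: u) y).
    rewrite levy_exponentE ImM/= mul0r addr0 mulrDr; congr (_ + _).
    rewrite dotrZr; field.
    by rewrite addrC natr1.
  rewrite -[X in _ --> X]addr0; under eq_fun do rewrite e.
  apply: cvgD.
    rewrite -[X in _ --> X](mul0r (dotr b u)); apply: cvgM => //; exact: cvg_cst.
  apply: cvg0; [exact: measurable_jump_im|exact: jump_im_le|].
  move=> n y; rewrite (le_trans (ler_normB _ _))//.
  have := sin_max (dotr (n.+1%:R *: u) y).
  rewrite dotrZl !normrM (ger0_norm (ltW (n0 n))) normr_nat.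
  have : n.+1%:R * `|dotr u y| * (enorm y <= 1)%R%:R <= n.+1%:R * `|dotr u y|.
    by rewrite ler_piMr ?mulr_ge0//; case: (enorm y <= 1).
  by lra.
Qed.

(** Each approximant is itself a characteristic function, that of
    [n.+1%:R *: L (t * n.+1%:R ^- 2)]. *)
Lemma opbound_gaussian (dO : measure_display) (Omega : measurableType dO)
    (P : probability Omega R) (L : R -> Omega -> V) b A t : 0 <= t ->
  (forall t, 0 <= t -> measurable_fun setT (L t)) ->
  (forall t u, 0 <= t -> charfun P (L t) u = cexp (t%:C%C * levy_exponent b A nu u)) ->
  opbound (fun u => cexp (t%:C%C * (- (dotr u (u *m A) / 2))%:C%C)) 1.
Proof.
move=> t0 mL hL.
apply: (@opbound_lim _ _ (fun n u => cexp (t%:C%C *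
    ((n.+1%:R ^- 2)%:C%C * levy_exponent b A nu (n.+1%:R *: u))))).
  move=> u; apply: ccvg_cexp; apply: ccvgM; first exact: ccvg_cst.
  exact: levy_exponent_scaling.
apply: nearW => n.
have s0 : 0 <= t * n.+1%:R ^- 2 by rewrite mulr_ge0// invr_ge0 exprn_ge0.
have := opbound_charfun P (fun w => n.+1%:R *: L (t * n.+1%:R ^- 2) w) _.
move=> /(_ (measurableT_comp (measurable_scaling _) (mL _ s0))).
apply: eq_opbound => u; rewrite -charfunZ hL//; congr cexp.
by rewrite mulrA rmorphM.
Qed.

Definition far n : set V := [set y | n.+1%:R^-1 < enorm y].

Lemma measurable_far n : measurable (far n).
Proof.
rewrite (_ : far n = enorm @^-1` `]n.+1%:R^-1, +oo[%classic).
  by rewrite -[X in measurable X]setTI; exact: measurable_enorm.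
by apply/seteqP; split => y /=; rewrite in_itv/= andbT.
Qed.

Lemma measurable_far_weight n : measurable_fun setT (\1_(far n) : V -> R).
Proof. exact: measurable_indic (measurable_far n). Qed.

Lemma integrable_far n : nu.-integrable setT (EFin \o (\1_(far n) : V -> R)).
Proof.
apply: (dominated_Rintegrable _ _ _ (fun y => n.+1%:R ^+ 2 * mn y)) => [||y].
- exact: measurable_far_weight.
- exact: integrable_mnZ.
have n0 : 0 < n.+1%:R :> R by rewrite ltr0n.
rewrite ger0_norm// indicE; have [/set_mem/= yn|_] := boolP (y \in far n); last first.
  by rewrite mulr_ge0// ?exprn_ge0.
rewrite -ler_pdivrMl ?exprn_gt0// mulr1 le_min; apply/andP; split.
  by rewrite invf_le1 ?exprn_gt0// exprn_ege1// ler1n.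
by rewrite -exprVn lerXn2r ?nnegrE ?invr_ge0 ?enorm_ge0// ltW.
Qed.

Lemma cvg_far_integral (f : V -> R) a : measurable_fun setT f ->
  (forall y, `|f y| <= a * Num.min 1 (enorm y ^+ 2)) ->
  \int[nu]_y (\1_(far n) y * f y) @[n --> \oo] --> \int[nu]_y f y.
Proof.
move=> mf fa; apply: (dominated_Rintegral_cvg _ _ _ _ (fun y => a * mn y)) => //.
- by move=> n; apply: measurable_funM => //; exact: measurable_far_weight.
(* At the origin, which no truncation reaches, the majorant forces [f] to vanish. *)
- move=> y; have [y0|y0] := eqVneq (enorm y) 0.
    have fy0 : f y = 0.
      apply/eqP; rewrite -normr_le0 (le_trans (fa y))// y0 expr0n/=.
      by rewrite min_r// mulr0.
    by rewrite fy0; under eq_fun do rewrite mulr0; exact: cvg_cst.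
  have y1 : 0 < enorm y by rewrite lt_neqAle eq_sym y0 enorm_ge0.
  apply: cvg_near_cst; near=> n.
  rewrite indicE mem_set ?mul1r//=.
  rewrite /far/= invf_plt ?posrE ?ltr0n//.
  rewrite (@le_lt_trans _ _ n%:R) ?ltr_nat//.
  by near: n; exact: nbhs_infty_ger.
- move=> n y; rewrite normrM (le_trans _ (fa y))// ler_piMl//.
  by rewrite indicE; case: (y \in _); rewrite ?normr1 ?normr0.
Unshelve. all: by end_near. Qed.

(** The compensator of the jumps kept by the truncation, to be absorbed into the drift. *)
Definition far_drift n : V := \row_i \int[nu]_y (\1_(far n) y * (y 0 i * (enorm y <= 1)%R%:R)).

Let small_le (y : V) (i : 'I_d) : `|y 0 i * small y| <= 1.
Proof.
rewrite /small; case: (leP (enorm y) 1) => y1; last by rewrite mulr0 normr0.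
by rewrite mulr1 (le_trans (norm_coord_le_enorm _ _)).
Qed.

Lemma far_driftP n u :
  nu.-integrable setT (EFin \o (fun y => \1_(far n) y * (dotr u y * small y))) /\
  \int[nu]_y (\1_(far n) y * (dotr u y * small y)) = dotr (far_drift n) u.
Proof.
pose f (i : 'I_d) (y : V) := u 0 i * (\1_(far n) y * (y 0 i * small y)).
have ic i : nu.-integrable setT (EFin \o (fun y => \1_(far n) y * (y 0 i * small y))).
  apply: (dominated_Rintegrable _ _ _ (\1_(far n) : V -> R)) => [||y].
  - apply: measurable_funM; first exact: measurable_far_weight.
    by apply: measurable_funM; [exact: measurable_coord|exact: measurable_small].
  - exact: integrable_far.
  - by rewrite normrM ger0_norm// ler_piMr.
have fi i : nu.-integrable setT (EFin \o f i).
  have := integrableZl measurableT (u 0 i) (ic i).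
  by apply: eq_integrable => //= y _; rewrite EFinM.
have [i1 i2] := Rintegral_sum _ _ _ nu _ (index_enum 'I_d) f fi.
have fE : (fun y => \1_(far n) y * (dotr u y * small y)) =
    (fun y => \sum_(i <- index_enum 'I_d) f i y).
  apply/funext => y; rewrite /dotr mulr_suml mulr_sumr.
  by apply: eq_bigr => i _; rewrite /f; ring.
split; first by rewrite fE.
rewrite /Rintegral; under eq_integral => y _ do rewrite [_ * _](congr1 (@^~ y) fE).
rewrite -/(Rintegral _ _ _) i2; apply: eq_bigr => i _.
by rewrite /f RintegralZl// mxE mulrC.
Qed.

Definition far_mass n : R := \int[nu]_y \1_(far n) y.
Definition far_ft n u : R[i] := wft nu (\1_(far n)) id u.

(** [nu] is finite on [far n], so there the integral splits into a compound Poisson exponent and a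
    compensator. *)
Lemma levy_exponent_approx b A u :
  ccvg (fun n => (0 +i* dotr (b - far_drift n) u)%C + (- (dotr u (u *m A) / 2))%:C%C
     + (far_ft n u - (far_mass n)%:C%C)) (levy_exponent b A nu u).
Proof.
have mw n := measurable_far_weight n; have iw n := integrable_far n.
have mid := @measurable_id _ V setT.
rewrite levy_exponentE; split.
- have e n : complex.Re ((0 +i* dotr (b - far_drift n) u)%C + (- (dotr u (u *m A) / 2))%:C%C
     + (far_ft n u - (far_mass n)%:C%C)) =
     - (dotr u (u *m A) / 2) + \int[nu]_y (\1_(far n) y * jump_re u y).
    rewrite !ReImE Re_wft/= add0r; congr (_ + _).
    rewrite /far_mass -RintegralB//; last exact: (integrable_weighted_Re nu _ id).
    by apply: eq_Rintegral => y _; rewrite /jump_re expR0; ring.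
  under eq_fun do rewrite e.
  apply: cvgD; first exact: cvg_cst.
  exact: (cvg_far_integral _ _ (measurable_jump_re u) (jump_re_le u)).
- have e n : complex.Im ((0 +i* dotr (b - far_drift n) u)%C + (- (dotr u (u *m A) / 2))%:C%C
     + (far_ft n u - (far_mass n)%:C%C)) =
     dotr b u + \int[nu]_y (\1_(far n) y * jump_im u y).
    have [i1 i2] := far_driftP n u.
    rewrite !ReImE Im_wft/= addr0 oppr0 addr0 dotrDl dotrNl -i2 -addrA; congr (_ + _).
    rewrite addrC -RintegralB//; last exact: (integrable_weighted_Im nu _ id).
    by apply: eq_Rintegral => y _; rewrite /jump_im /small expR0; ring.
  under eq_fun do rewrite e.
  apply: cvgD; first exact: cvg_cst.
  exact: (cvg_far_integral _ _ (measurable_jump_im u) (jump_im_le u)).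
Qed.

(* The measure [nu - k rho] is never formed: only its positivity away from the
   origin, in the form of the hypothesis [k_le_far], is needed. *)
Section subtract_part.
Variables (rho : {measure set V -> \bar R}) (k : V -> R).
Hypotheses (mk : measurable_fun setT k) (ik : rho.-integrable setT (EFin \o k)).
Hypothesis k_le_far : \forall n \near \oo, forall h : V -> R,
  measurable_fun setT h -> (forall y, 0 <= h y) -> (exists M, forall y, `|h y| <= M) ->
  \int[rho]_y (k y * h y) <= \int[nu]_y (\1_(far n) y * h y).

Let lam : R := \int[rho]_y k y.
Let G u : R[i] := wft rho k id u.

(** Testing the domination on the nonnegative functions [M + tpoly p (x + y)] and
    [M - tpoly p (x + y)] gives the two sides of the bound, as for averaging against a positive
    measure of mass [far_mass n - lam]. *)
Lemma opbound_far_sub : \forall n \near \oo,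
  0 <= far_mass n - lam /\ opbound (fun u => far_ft n u - G u) (far_mass n - lam).
Proof.
have mid := @measurable_id _ V setT.
apply: filterS k_le_far => n hn; split.
  have e1 : \int[rho]_y (k y * 1) = lam.
    by apply: eq_Rintegral => y _; rewrite mulr1.
  have e2 : \int[nu]_y (\1_(far n) y * 1) = far_mass n.
    by apply: eq_Rintegral => y _; rewrite mulr1.
  rewrite subr_ge0 -e1 -e2; apply: hn => //.
  by exists 1 => y; rewrite normr1.
have mw := measurable_far_weight n; have iw := integrable_far n.
move=> p M pM x; rewrite tpoly_tmulB !tpoly_tmul_wft//.
set a := Rintegral nu _ _; set b := Rintegral rho _ _.
have iwp := integrable_weighted_tpoly nu _ id mw iw mid p x.
have ikp := integrable_weighted_tpoly rho _ id mk ik mid p x.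
have mp : measurable_fun setT (fun y => tpoly p (x + y)).
  exact: (measurableT_comp (measurable_tpoly p) (measurable_translation x)).
have iwM : nu.-integrable setT (EFin \o (fun y => \1_(far n) y * M)).
  have := integrableZr measurableT M iw.
  by apply: eq_integrable => //= y _; rewrite EFinM.
have ikM : rho.-integrable setT (EFin \o (fun y => k y * M)).
  have := integrableZr measurableT M ik.
  by apply: eq_integrable => //= y _; rewrite EFinM.
have bd : forall y, - M <= tpoly p (x + y) <= M by move=> y; rewrite -ler_norml.
have h1 : lam * M + b <= far_mass n * M + a.
  rewrite /lam /far_mass -!RintegralZr// /a /b -!RintegralD//.
  have e1 : \int[rho]_y (k y * (M + tpoly p (x + y))) =
      \int[rho]_y (k y * M + k y * tpoly p (x + y)).
    by apply: eq_Rintegral => y _; rewrite mulrDr.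
  have e2 : \int[nu]_y (\1_(far n) y * (M + tpoly p (x + y))) =
      \int[nu]_y (\1_(far n) y * M + \1_(far n) y * tpoly p (x + y)).
    by apply: eq_Rintegral => y _; rewrite mulrDr.
  rewrite -e1 -e2; apply: hn.
  - by apply: measurable_funD.
  - by move=> y; have := bd y; lra.
  - by exists (M + M) => y; rewrite ler_norml; have := bd y; lra.
have h2 : lam * M - b <= far_mass n * M - a.
  rewrite /lam /far_mass -!RintegralZr// /a /b -!RintegralB//.
  have e1 : \int[rho]_y (k y * (M - tpoly p (x + y))) =
      \int[rho]_y (k y * M - k y * tpoly p (x + y)).
    by apply: eq_Rintegral => y _; rewrite mulrBr.
  have e2 : \int[nu]_y (\1_(far n) y * (M - tpoly p (x + y))) =
      \int[nu]_y (\1_(far n) y * M - \1_(far n) y * tpoly p (x + y)).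
    by apply: eq_Rintegral => y _; rewrite mulrBr.
  rewrite -e1 -e2; apply: hn.
  - by apply: measurable_funB.
  - by move=> y; have := bd y; lra.
  - by exists (M + M) => y; rewrite ler_norml; have := bd y; lra.
rewrite ler_norml mulrBl; apply/andP; split; lra.
Qed.

Lemma opbound_cexp_far_sub t : 0 <= t -> \forall n \near \oo,
  opbound (fun u => cexp (t%:C%C * ((far_ft n u - (far_mass n)%:C%C) - (G u - lam%:C%C)))) 1.
Proof.
move=> t0; apply: filterS opbound_far_sub => n [l0 hl].
apply: opbound_cexp.
have : \forall N \near \oo, t * (far_mass n - lam) <= N%:R by exact: nbhs_infty_ger.
apply: filterS => N tN.
have N0 : 0 < N.+1%:R :> R by rewrite ltr0n.
pose s := t / N.+1%:R; have s0 : 0 <= s by rewrite divr_ge0// ltW.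
have sl : s * (far_mass n - lam) <= 1.
  by rewrite /s mulrAC ler_pdivrMr// mul1r (le_trans tN)// ler_nat leqnSn.
(* For large [N] the scalar part is nonnegative, so the norms of the two summands of 1 + t chi / N
   add up to exactly 1. *)
have e1 : `|1 - s * (far_mass n - lam)| + `|s| * (far_mass n - lam) = 1.
  by rewrite (ger0_norm s0) ger0_norm ?subr_ge0//; ring.
have := opboundD _ _ _ _ (opbound_cst (1 - s * (far_mass n - lam))) (opboundZ s _ _ hl).
rewrite e1; apply: eq_opbound => u.
rewrite !(rmorphB, rmorphM, rmorph1)/= fmorphV rmorph_nat.
by field; rewrite addrC natr1 pnatr_eq0.
Qed.

Lemma opbound_levy_sub b A t : 0 <= t ->
  opbound (fun u => cexp (t%:C%C * (- (dotr u (u *m A) / 2))%:C%C)) 1 ->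
  opbound (fun u => cexp (t%:C%C * (levy_exponent b A nu u - (G u - lam%:C%C)))) 1.
Proof.
move=> t0 hg.
apply: (@opbound_lim _ _ (fun n u => cexp (t%:C%C *
    ((0 +i* dotr (b - far_drift n) u)%C + (- (dotr u (u *m A) / 2))%:C%C
     + (far_ft n u - (far_mass n)%:C%C) - (G u - lam%:C%C))))).
  move=> u; apply: ccvg_cexp; apply: ccvgM; first exact: ccvg_cst.
  by apply: ccvgD; [exact: levy_exponent_approx|exact: ccvg_cst].
apply: filterS (opbound_cexp_far_sub _ t0) => n hn.
have := opboundM _ _ _ _ (opboundM _ _ _ _ (opbound_wave (t *: (b - far_drift n))) hg) hn.
rewrite !mulr1; apply: eq_opbound => u; rewrite -!cexpD; congr cexp.
rewrite -[(0 +i* dotr u (t *: (b - far_drift n)))%C](_ : t%:C%C * (0 +i* dotr (b - far_drift n) u)%C = _).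
  by ring.
by apply: complex_eqP; rewrite ReImE/= ?dotrZr ?mulr0 ?mul0r ?subr0 ?addr0// dotrC.
Qed.

End subtract_part.

End Levy_exponent.

(** * Modulus of continuity *)

Section smoothing.
Context {R : realType} {d : nat} {dO : measure_display}.
Context {Omega : measurableType dO} (P : probability Omega R).
Local Notation V := 'rV[R]_d.
Local Notation leb := (lebesgue_rV d : {measure set V -> \bar R}).

Lemma cexp_real (x : R) : cexp x%:C%C = (expR x)%:C%C.
Proof. by apply: complex_eqP; rewrite /= ?cos0 ?sin0 ?mulr1 ?mulr0. Qed.

Lemma opbound_levy_increment (L : R -> Omega -> V) (nu : {measure set V -> \bar R})
    b A (t k s : R) (h : V) :
  (forall t, 0 <= t -> measurable_fun setT (L t)) ->
  levy_khintchine_triplet P L b A nu ->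
  (\forall n \near \oo, forall f : V -> R,
    measurable_fun setT f -> (forall y, 0 <= f y) -> (exists M, forall y, `|f y| <= M) ->
    \int[leb]_y (cube_weight k s y * f y) <= \int[nu]_y (\1_(far n) y * f y)) ->
  0 <= t -> 0 <= k -> 0 < s -> enorm h <= s ->
  opbound (fun u => charfun P (L t) u * (1 - wave u h))
    (2 * expR (- (t * (k * s ^+ d))) + 2 * d%:R * enorm h / s).
Proof.
move=> mL trip dom t0 k0 s0 hs.
have mk := measurable_cube_weight (d := d) k s.
have ik := integrable_cube_weight (d := d) k s (ltW s0).
have mid := @measurable_id _ V setT.
pose lam := k * s ^+ d.
have lamE : \int[leb]_y cube_weight k s y = lam by exact: Rintegral_cube_weight (ltW s0).
have lam0 : 0 <= lam by rewrite mulr_ge0// exprn_ge0// ltW.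
pose G := wft leb (cube_weight k s) id.
have hgauss := opbound_gaussian nu (triplet_nu_integrable trip) _ _ P L b A t t0 mL
  (triplet_charfun trip).
have h1 := opbound_levy_sub nu (triplet_nu_integrable trip) leb (cube_weight k s)
  mk ik dom b A t t0 hgauss.
have kn0 y : 0 <= cube_weight k s y by rewrite mulr_ge0.
have hG : opbound (fun u => t%:C%C * G u) (t * lam).
  have := opboundZ t _ _ (opbound_wft leb (cube_weight k s) id mk ik mid).
  rewrite ger0_norm// (_ : \int[leb]_y _ = lam)// -lamE.
  by apply: eq_Rintegral => y _; rewrite ger0_norm.
pose r := 2 * d%:R * enorm h / s.
have r0 : 0 <= r by rewrite divr_ge0 ?mulr_ge0 ?enorm_ge0// ltW.
have hv : opbound (fun u => 1 - wave u h) 2.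
  have := opboundD _ _ _ _ opbound1 (opboundZ (-1) _ _ (opbound_wave h)).
  rewrite normrN1 mulr1 (_ : 1 + 1 = 2)//; apply: eq_opbound => u.
  by rewrite rmorphN1 mulN1r.
have hvG : opbound (fun u => (1 - wave u h) * (t%:C%C * G u)) (r * (t * lam)).
  have := opboundZ t _ _ (opbound_cube_translate k s h k0 hs s0).
  rewrite ger0_norm// -/lam -/r (_ : t * (lam * r) = r * (t * lam)); last by ring.
  by apply: eq_opbound => u; rewrite -/(G u); ring.
(* Writing exp (t G) = 1 + (exp (t G) - 1) separates the jumpless term, of norm 2, from a term of
   norm [r * expR (t * lam)], whose exponential cancels against [expR (- (t * lam))]. *)
have h2 := opboundD _ _ _ _ hv (opbound_mul_cexpB1 _ _ _ _ (mulr_ge0 t0 lam0) r0 hG hvG).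
have := opboundM _ _ _ _ h1 (opboundZ (expR (- (t * lam))) _ _ h2).
rewrite mul1r ger0_norm ?expR_ge0// mulrDr (mulrC r) (mulrA (expR _) (expR _)) -expRD.
rewrite addNr expR0 mul1r (mulrC _ 2); apply: eq_opbound => u.
rewrite (triplet_charfun trip)// -cexp_real lamE.
transitivity (cexp (t%:C%C * (levy_exponent b A nu u - (G u - lam%:C%C))) *
  cexp (- (t * lam))%:C%C * cexp (t%:C%C * G u) * (1 - wave u h)).
  by rewrite -/G; ring.
rewrite -!cexpD; congr (cexp _ * _).
have -> : (- (t * lam))%:C%C = - (t%:C%C * lam%:C%C) :> R[i].
  by rewrite -rmorphM -rmorphN.
by ring.
Qed.

Variables (X : Omega -> V) (h : V) (eta : R).
Hypotheses (mX : measurable_fun setT X)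
  (hX : opbound (fun u => charfun P X u * (1 - wave u h)) eta).

Let integrable_bounded (f : V -> R) M x : measurable_fun setT f ->
  (forall y, `|f y| <= M) -> P.-integrable setT (EFin \o (fun w => f (x + X w))).
Proof.
move=> mf fM; apply: (dominated_Rintegrable _ _ _ (fun=> M)) => //.
  apply: (measurableT_comp mf).
  exact: (measurableT_comp (measurable_translation x) mX).
exact: finite_measure_integrable_cst.
Qed.

(** For a trigonometric polynomial the difference is the multiplier of [hX] applied to it; the
    induction along limits is dominated convergence. *)
Lemma baire_translate_le f x : baire f ->
  `|\int[P]_w f (x + X w) - \int[P]_w f (x + h + X w)| <= eta.
Proof.
elim=> [{}f [p ->] f01|fs {}f bf IH cvf].
  have := hX p 1 _ x; rewrite mulr1.
  have -> : tpoly (tmul (fun u => charfun P X u * (1 - wave u h)) p) x =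
      \int[P]_w tpoly p (x + X w) - \int[P]_w tpoly p (x + h + X w).
    rewrite -!tpoly_tmul_charfun// -tpoly_tmul_wave -tmul_comp -tpoly_tmulB.
    by congr (tpoly (tmul _ p) x); apply/funext => u; ring.
  by apply=> y; rewrite ger0_norm; have /andP[] := f01 y.
have cv z : \int[P]_w fs n (z + X w) @[n --> \oo] --> \int[P]_w f (z + X w).
  apply: (dominated_Rintegral_cvg _ _ _ _ (fun=> 1)).
  - move=> n; apply: (measurableT_comp (measurable_baire _ (bf n))).
    exact: (measurableT_comp (measurable_translation z) mX).
  - apply: (measurableT_comp (measurable_baire _ (baire_lim _ _ bf cvf))).
    exact: (measurableT_comp (measurable_translation z) mX).
  - exact: finite_measure_integrable_cst.
  - by move=> w; exact: cvf.
  - by move=> n w; have /andP[? ?] := baire_itv _ (bf n) (z + X w); rewrite ger0_norm.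
have cvn : `|\int[P]_w fs n (x + X w) - \int[P]_w fs n (x + h + X w)| @[n --> \oo] -->
    `|\int[P]_w f (x + X w) - \int[P]_w f (x + h + X w)|.
  by apply: cvg_norm; apply: cvgB; exact: cv.
rewrite -(cvg_lim _ cvn)//; apply: limr_le; first by apply/cvg_ex; eexists; exact: cvn.
by apply: nearW => n; exact: IH.
Qed.

Lemma bounded_translate_le (f : V -> R) M x : measurable_fun setT f ->
  (forall y, `|f y| <= M) ->
  `|\int[P]_w f (x + X w) - \int[P]_w f (x + h + X w)| <= 2 * M * eta.
Proof.
move=> mf fM; have M0 : 0 <= M by apply: le_trans (fM 0).
move: M0; rewrite le_eqVlt => /predU1P[M0|M0].
  have f0 y : f y = 0.
    by apply/eqP; rewrite -normr_le0 M0.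
  have e z : \int[P]_w f (z + X w) = 0.
    by under eq_Rintegral do rewrite f0; rewrite Rintegral_cst// mul0r.
  by rewrite !e subrr normr0 -M0 mulr0 mul0r.
have M20 : 0 < 2 * M by rewrite mulr_gt0.
(* Maps [-M, M] onto [0, 1]; the added 1/2 cancels in the difference and the scaling returns as the
   factor 2 M. *)
pose f' y := (2 * M)^-1 * f y + 1 / 2.
have mf' : measurable_fun setT f'.
  by apply: measurable_funD => //; apply: measurable_funM.
have f'01 y : 0 <= f' y <= 1.
  have : `|(2 * M)^-1 * f y| <= 1 / 2.
    rewrite normrM normfV (ger0_norm (ltW M20)) ler_pdivrMl//.
    by rewrite (le_trans (fM y))//; lra.
  by rewrite /f' ler_norml => /andP[? ?]; apply/andP; split; lra.
have := baire_translate_le _ x (baire_measurable _ mf' f'01).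
have e z : \int[P]_w f' (z + X w) = (2 * M)^-1 * (\int[P]_w f (z + X w)) + \int[P]_w (cst (1 / 2) w).
  have i1 := integrable_bounded f M z mf fM.
  rewrite -RintegralZl// -RintegralD//.
    have := integrableZl measurableT (2 * M)^-1 i1.
    by apply: eq_integrable => //= w _; rewrite EFinM.
  exact: finite_measure_integrable_cst.
rewrite !e opprD addrACA subrr addr0 -mulrBr normrM normfV (ger0_norm (ltW M20)).
by rewrite ler_pdivrMl.
Qed.

End smoothing.

(* [alpha] stands for the exponent 2 alpha of the theorem. *)
Section domination.
Context {R : realType} {d : nat}.
Local Notation V := 'rV[R]_d.
Local Notation leb := (lebesgue_rV d : {measure set V -> \bar R}).
Variables (nu : {measure set V -> \bar R}) (g : V -> \bar R) (alpha : R).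
Hypotheses (hd : (0 < d)%N) (halpha : 0 < alpha).
Hypothesis nu_int : (\int[nu]_y (Num.min 1 (enorm y ^+ 2))%:E < +oo)%E.
Hypothesis nu_g : density_on nu unit_eball g.
Hypothesis g_ge : {ae lebesgue_rV d, forall x, unit_eball x ->
    ((`|log2 (enorm x)| `^ alpha / enorm x ^+ d)%:E <= g x)%E}.
Variable s : R.
Hypotheses (s0 : 0 < s) (s1 : d%:R * (s *+ 2) < 1).

(** The prescribed lower density at radius 2 d s, an upper bound for the norm on the cube; inside
    the unit ball this density decreases with the radius. *)
Definition density_bound : R :=
  `|log2 (d%:R * (s *+ 2))| `^ alpha / (d%:R * (s *+ 2)) ^+ d.

Let z := d%:R * (s *+ 2).

Let z0 : 0 < z.
Proof. by rewrite mulr_gt0 ?ltr0n// mulrn_wgt0. Qed.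

Lemma density_bound_ge0 : 0 <= density_bound.
Proof. by rewrite divr_ge0 ?powR_ge0// exprn_ge0// ltW. Qed.

Lemma ln2_gt0 : 0 < ln 2 :> R.
Proof. by rewrite ln_gt0// ltr1n. Qed.

Lemma log2_le0 (a : R) : a <= 1 -> log2 a <= 0.
Proof. by move=> a1; rewrite /log2 pmulr_lle0 ?invr_gt0 ?ln2_gt0// ln_le0. Qed.

Lemma cube_enorm (y : V) : cube s y -> s <= enorm y <= z.
Proof.
move=> cy; have cy' i : s <= y 0 i <= s *+ 2 by have := cy i; rewrite /= in_itv.
apply/andP; split.
  have /andP[h _] := cy' (Ordinal hd); apply: (le_trans h).
  exact: le_trans (ler_norm _) (norm_coord_le_enorm _ _).
apply: enorm_le_coord => [|i]; first by rewrite mulrn_wge0// ltW.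
by have /andP[h1 h2] := cy' i; rewrite ger0_norm// (le_trans (ltW s0)).
Qed.

Lemma cube_sub_eball : (cube s : set V) `<=` unit_eball.
Proof. by move=> y /cube_enorm /andP[_ h]; exact: le_lt_trans s1. Qed.

Lemma density_bound_le (y : V) : cube s y ->
  density_bound <= `|log2 (enorm y)| `^ alpha / enorm y ^+ d.
Proof.
move=> /cube_enorm /andP[y0 yz]; have {}y0 := lt_le_trans s0 y0.
rewrite ler_pM ?powR_ge0 ?invr_ge0 ?exprn_ge0 ?(ltW z0)//; last first.
  by rewrite lef_pV2 ?posrE ?exprn_gt0// lerXn2r// nnegrE ltW.
apply: ge0_ler_powR; rewrite ?nnegrE ?normr_ge0 ?(ltW halpha)//.
rewrite !ler0_norm ?log2_le0 ?(ltW s1) ?(le_trans yz) ?(ltW s1)// lerN2.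
by rewrite ler_pM2r ?invr_gt0 ?ln2_gt0// ler_ln ?posrE.
Qed.

Lemma nu_ge_lebesgue S : measurable S -> S `<=` cube s ->
  (density_bound%:E * leb S <= nu S)%E.
Proof.
move=> mS Sc; have Sb := subset_trans Sc cube_sub_eball.
have [mg g0 nuE] := nu_g.
rewrite nuE// -integral_cst//.
apply: ae_ge0_le_integral => //.
- by move=> x _; rewrite lee_fin density_bound_ge0.
- by move=> x Sx; apply: g0; exact: Sb.
- apply: measurable_funS mg => //.
  by rewrite (_ : unit_eball = enorm @^-1` `]-oo, 1[%classic);
    [rewrite -[X in measurable X]setTI; exact: measurable_enorm|
     apply/seteqP; split => x /=; rewrite in_itv].
- apply: filterS g_ge => x gx Sx; apply: le_trans (gx (Sb _ Sx)).
  by rewrite lee_fin density_bound_le//; exact: Sc.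
Qed.

Lemma cube_weight_le_far : \forall n \near \oo, forall f : V -> R,
  measurable_fun setT f -> (forall y, 0 <= f y) -> (exists M, forall y, `|f y| <= M) ->
  \int[leb]_y (cube_weight density_bound s y * f y) <= \int[nu]_y (\1_(far n) y * f y).
Proof.
near=> n => f mf f0 [M fM].
have kk0 := density_bound_ge0.
have mid := @measurable_id _ V setT.
have cf : (cube s : set V) `<=` far n.
  move=> y /cube_enorm /andP[h _]; rewrite /far/=; apply: lt_le_trans h.
  rewrite invf_plt ?posrE ?ltr0n//.
  rewrite (@le_lt_trans _ _ n%:R) ?ltr_nat//.
  by near: n; exact: nbhs_infty_ger.
have mc := measurable_cube (R := R) (d := d) s.
have i1 := integrable_weighted leb _ id (measurable_cube_weight density_bound s)
  (integrable_cube_weight _ _ (ltW s0)) mid f M mf fM.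
have i2 := integrable_weighted nu _ id (measurable_far_weight n)
  (integrable_far nu nu_int n) mid f M mf fM.
have mEf : measurable_fun (cube s) (EFin \o f).
  by apply/measurable_EFinP; exact: measurable_funTS.
apply: fine_le; [exact: integrable_fin_num|exact: integrable_fin_num|].
rewrite [leLHS](_ : _ = \int[mscale (NngNum kk0) leb]_(y in cube s) (f y)%:E)%E; last first.
  rewrite ge0_integral_mscale//=; last by move=> y _; rewrite lee_fin.
  rewrite -ge0_integralZl//; last by move=> y _; rewrite lee_fin.
  rewrite [RHS]integral_mkcond; apply: eq_integral => y _.
  rewrite patchE /cube_weight indicE; case: ifPn => yc.
    by rewrite mulr1 EFinM.
  by rewrite mulr0 mul0r.
rewrite [leRHS](_ : _ = \int[nu]_(y in far n) (f y)%:E)%E; last first.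
  rewrite [RHS]integral_mkcond; apply: eq_integral => y _.
  by rewrite patchE indicE; case: ifPn => yc; rewrite ?mul1r ?mul0r.
apply: (@le_trans _ _ (\int[nu]_(y in cube s) (f y)%:E)%E).
  apply: ge0_le_measure_integral_in => //.
    by move=> S mS Sc; exact: nu_ge_lebesgue.
  by move=> x _; rewrite lee_fin.
apply: ge0_subset_integral => //; first exact: measurable_far.
  by apply/measurable_EFinP; exact: measurable_funTS.
by move=> x _; rewrite lee_fin.
Unshelve. all: by end_near. Qed.

(** The powers of [s] cancel: a density |x|^-d alone would give cubes of every scale comparable
    mass, and it is the logarithm that makes the jump intensity blow up as [s] tends to 0. *)
Lemma density_bound_mass : density_bound * s ^+ d =
  `|log2 z| `^ alpha / (d%:R *+ 2) ^+ d.
Proof.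
have sn0 : s != 0 by rewrite gt_eqF.
have dn0 : d%:R *+ 2 != 0 :> R by rewrite gt_eqF// mulrn_wgt0// ltr0n.
rewrite /density_bound -/z (_ : z = (d%:R *+ 2) * s); last first.
  by rewrite /z !mulr2n mulrDr mulrDl.
by rewrite exprMn; field; rewrite !expf_neq0.
Qed.

End domination.

(** * Explicit rate for the choice s = sqrt |h| *)

Section decay_rate.
Context {R : realType}.
Implicit Types (e l a x : R).

(** With K = a / x, a ln l = a ln K + a ln (l / K) <= a ln K + a l / K, and a / K = x. *)
Lemma powR_le_expR l a x : 0 < l -> 0 < a -> 0 < x ->
  l `^ a <= (a / x) `^ a * expR (x * l).
Proof.
move=> l0 a0 x0; have K0 : 0 < a / x by rewrite divr_gt0.
rewrite -[leLHS](@lnK _ (l `^ a)) ?posrE ?powR_gt0//.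
rewrite -[X in X * _](@lnK _ ((a / x) `^ a)) ?posrE ?powR_gt0//.
rewrite -expRD ler_expR !ln_powR.
have -> : l = (a / x) * (l / (a / x)) by field; rewrite !gt_eqF.
rewrite lnM ?posrE ?divr_gt0//.
have h : ln (l / (a / x)) <= l / (a / x) by rewrite ltW// ln_sublinear// divr_gt0.
have h2 := ler_wpM2l (ltW a0) h.
have e1 : a * (l / (a / x)) = x * l by field; rewrite !gt_eqF.
have e2 : x * (a / x * (l / (a / x))) = x * l by field; rewrite !gt_eqF.
by rewrite e2 mulrDr lerD2l -e1.
Qed.

Lemma expRN_le_inv x : 0 < x -> expR (- x) <= x^-1.
Proof.
move=> x0; rewrite expRN lef_pV2 ?posrE ?expR_gt0//.
by rewrite (le_trans _ (expR_ge1Dx x))// lerDr.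
Qed.

End decay_rate.

Section modulus.
Context {R : realType}.
Variables (d : nat) (alpha : R).
Hypotheses (hd : (0 < d)%N) (halpha : 1 < alpha).

(** For e <= (2 d)^-4 and s = sqrt e one has 2 d s <= e^(1/4) < 1, which puts the cube in the unit
    ball and gives |log2 (2 d s)| >= |log2 e| / 4. *)
Definition radius : R := (d%:R *+ 2) ^- 4.

(** One summand for each term of the multiplier bound. The power of 1/4 is the cost of replacing
    log2 (2 d s) by log2 e; the second summand comes from [powR_le_expR] with x = ln 2 / 2. *)
Definition rate_cst (t : R) : R :=
  2 * (t * (4^-1 `^ (2 * alpha) / (d%:R *+ 2) ^+ d))^-1 +
  2 * d%:R * ((alpha - 1) / (ln 2 / 2)) `^ (alpha - 1).

Let D0 : 1 < d%:R *+ 2 :> R.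
Proof. by rewrite -[d%:R *+ 2]mulr_natr -natrM ltr1n leq_pmull. Qed.

Let radius_gt0 : 0 < radius.
Proof. by rewrite invr_gt0 exprn_gt0// (lt_trans ltr01). Qed.

Let radius_lt1 : radius < 1.
Proof. by rewrite invf_lt1 ?exprn_gt0 ?(lt_trans ltr01)// exprn_egt1. Qed.

Lemma modulus_le (t e : R) : 0 < t -> 0 < e -> e <= radius ->
  let s := Num.sqrt e in
  [/\ e <= s, d%:R * (s *+ 2) < 1 &
    2 * expR (- (t * (density_bound (d := d) (2 * alpha) s * s ^+ d))) +
    2 * d%:R * e / s <= rate_cst t / `|log2 e| `^ (alpha - 1)].
Proof.
move=> t0 e0 er s.
have Dp : 0 < d%:R *+ 2 :> R by exact: lt_trans ltr01 D0.
have ln20 := @ln2_gt0 R.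
have s0 : 0 < s by rewrite sqrtr_gt0.
have ss : s ^+ 2 = e by rewrite sqr_sqrtr// ltW.
have lns : ln s = ln e / 2.
  have h : ln e = ln s + ln s by rewrite -ss lnXn// mulr2n.
  lra.
have zE : d%:R * (s *+ 2) = (d%:R *+ 2) * s by rewrite !mulr2n mulrDr mulrDl.
have lnr : ln e <= - 4 * ln (d%:R *+ 2).
  have : ln e <= ln radius by rewrite ler_ln// posrE.
  by rewrite /radius lnV ?posrE ?exprn_gt0// lnXn// -mulr_natr; lra.
have lnD : 0 < ln (d%:R *+ 2 : R) by rewrite ln_gt0.
have lnD2 : ln 2 <= ln (d%:R *+ 2 : R).
  by rewrite ler_ln ?posrE// -[d%:R *+ 2]mulr_natr -natrM ler_nat leq_pmull.
have lnz : ln (d%:R * (s *+ 2)) = ln (d%:R *+ 2) + ln e / 2.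
  by rewrite zE lnM// lns.
have z0 : 0 < d%:R * (s *+ 2) by rewrite zE mulr_gt0.
have z1 : d%:R * (s *+ 2) < 1.
  rewrite ltNge; apply/negP => /ln_ge0; rewrite lnz; lra.
split=> //.
  by rewrite -[leLHS]ss expr2 ler_piMl ?(ltW s0)// -sqrtr1 ler_sqrt// ltW// (le_lt_trans er).
pose l := `|log2 e|.
have lE : l = - ln e / ln 2.
  by rewrite /l /log2 ler0_norm ?mulNr// pmulr_lle0 ?invr_gt0//; lra.
have l1 : 1 <= l by rewrite lE ler_pdivlMr// mul1r; lra.
have l0 : 0 < l by exact: lt_le_trans ltr01 l1.
have a0 : 0 < alpha - 1 by rewrite subr_gt0.
have la0 : 0 < l `^ (alpha - 1) by rewrite powR_gt0.
have lz : l / 4 <= `|log2 (d%:R * (s *+ 2))|.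
  rewrite lE /log2 lnz ler0_norm; last first.
    by rewrite pmulr_lle0 ?invr_gt0//; lra.
  rewrite -mulNr [leLHS](_ : _ = - ln e / 4 / ln 2); last by ring.
  by rewrite ler_pM2r ?invr_gt0//; lra.
rewrite density_bound_mass//.
pose c := 4^-1 `^ (2 * alpha) / (d%:R *+ 2) ^+ d : R.
have c0 : 0 < c by rewrite divr_gt0 ?powR_gt0 ?exprn_gt0.
(* Since [1 <= l], the exponent [2 * alpha] may be lowered to [alpha - 1], the one for which the
   bound exp (- x) <= 1 / x yields the claimed rate. *)
have lam_ge : c * l `^ (alpha - 1) <= `|log2 (d%:R * (s *+ 2))| `^ (2 * alpha) / (d%:R *+ 2) ^+ d.
  rewrite /c mulrAC ler_pM2r ?invr_gt0 ?exprn_gt0//.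
  apply: (@le_trans _ _ (4^-1 `^ (2 * alpha) * l `^ (2 * alpha))).
    by rewrite ler_wpM2l ?powR_ge0// ler_powR//; lra.
  rewrite -powRM ?invr_ge0 ?(ltW l0)//.
  apply: ge0_ler_powR; rewrite ?nnegrE ?mulr_ge0 ?invr_ge0 ?(ltW l0)//; first lra.
  by rewrite mulrC.
rewrite /rate_cst -/c [leRHS]mulrDl lerD//.
  rewrite -!mulrA ler_pM2l// (@le_trans _ _ (expR (- (t * (c * l `^ (alpha - 1))))))//.
    by rewrite ler_expR lerN2 ler_pM2l.
  have tcl := mulr_gt0 t0 (mulr_gt0 c0 la0).
  by rewrite (le_trans (expRN_le_inv _ tcl))// mulrA invfM.
rewrite -!mulrA ler_pM2l// ler_pM2l ?ltr0n//.
have -> : e / s = s by rewrite -ss expr2 mulfK// gt_eqF.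
rewrite ler_pdivlMr//.
have h := powR_le_expR l (alpha - 1) (ln 2 / 2) l0 a0 (divr_gt0 ln20 (ltr0Sn _ 1)).
(* That is, s = 2^(- l / 2), which beats every power of [l]. *)
have sE : s = expR (- (ln 2 / 2 * l)).
  rewrite -[LHS]lnK ?posrE// lns; congr expR; rewrite lE; field.
  by rewrite gt_eqF.
rewrite -/l {1}sE; apply: (le_trans (ler_wpM2l (expR_ge0 _) h)).
by rewrite mulrCA -expRD addNr expR0 mulr1.
Qed.

End modulus.

Theorem theorem6p1 (R : realType) (d : nat) (alpha : R)
    (hd : (0 < d)%N) (halpha : 1 < alpha) :
  (* C may depend on d, alpha and on t, r0, ||f||_oo, but not on the process *)
  exists C : R -> R -> R -> R,
  forall (dO : measure_display) (Omega : measurableType dO)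
    (P : probability Omega R) (L : R -> Omega -> 'rV[R]_d)
    (nu : {measure set 'rV[R]_d -> \bar R}) (g : 'rV[R]_d -> \bar R),
  levy_process P L ->
  levy_measure P L nu ->
  abs_continuous_on nu unit_eball ->
  density_on nu unit_eball g ->
  {ae lebesgue_rV d, forall x, unit_eball x ->
    ((`|log2 (enorm x)| `^ (2 * alpha) / enorm x ^+ d)%:E <= g x)%E} ->
  strong_feller P L /\
  exists r0 : R, 0 < r0 /\
    forall (t : R) (f : 'rV[R]_d -> R), 0 < t -> Bb f ->
    forall x y : 'rV[R]_d, 0 < enorm (x - y) <= r0 ->
      `|semigroup P L t f x - semigroup P L t f y| <=
        C t r0 (supnorm f) / `|log2 (enorm (x - y))| `^ (alpha - 1).
Proof.
exists (fun t _ M => 2 * M * rate_cst d alpha t).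
move=> dO Omega P L nu g levyL [b [A trip]] _ nu_g g_ge.
have nu_int := triplet_nu_integrable trip.
have mL := levy_measurable levyL.
have ha2 : 0 < 2 * alpha by lra.
have fsup (f : 'rV[R]_d -> R) x : Bb f -> `|f x| <= supnorm f.
  (* [bounded_fun] bounds [f] by every number strictly above [K], whence [K + 1]. *)
  move=> [_ [K [_ fK]]]; apply: ub_le_sup; last by exists x.
  by exists (K + 1) => _ [y _ <-]; apply: fK => //; rewrite ltrDl.
have key (t : R) (f : 'rV[R]_d -> R) : 0 < t -> Bb f ->
    forall x y : 'rV[R]_d, 0 < enorm (x - y) <= radius d ->
    `|semigroup P L t f x - semigroup P L t f y| <=
      2 * supnorm f * rate_cst d alpha t / `|log2 (enorm (x - y))| `^ (alpha - 1).
  move=> t0 bf x y /andP[e0 er].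
  have e_sym : enorm (y - x) = enorm (x - y).
    by rewrite /enorm -opprB dotrNl dotrNr opprK.
  have [hs s1 rate] := modulus_le d alpha hd halpha t _ t0 e0 er.
  set s := Num.sqrt (enorm (x - y)) in hs s1 rate.
  have s0 : 0 < s by rewrite sqrtr_gt0.
  have dom := cube_weight_le_far nu g (2 * alpha) hd ha2 nu_int nu_g g_ge s s0 s1.
  have k0 := density_bound_ge0 (2 * alpha) hd s s0.
  rewrite -e_sym in hs.
  have mult := opbound_levy_increment P L nu b A t _ s (y - x) mL trip dom (ltW t0) k0 s0 hs.
  have := bounded_translate_le P (L t) (y - x) _ (mL t (ltW t0)) mult f (supnorm f) x bf.1
    (fun z => fsup f z bf).
  have -> : x + (y - x) = y by rewrite addrC subrK.
  rewrite e_sym => /le_trans; apply.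
  rewrite -[leRHS]mulrA ler_wpM2l// mulr_ge0//.
  exact: le_trans (fsup f 0 bf).
split; last first.
  exists (radius d); split; last by move=> t f t0 bf x y xy; exact: key.
  by rewrite invr_gt0 exprn_gt0// mulrn_wgt0// ltr0n.
move=> t t0 f bf; split; last first.
  exists (supnorm f); split; first exact: num_real.
  move=> N MN x _ /=; rewrite /semigroup.
  have if1 : P.-integrable setT (EFin \o (fun=> supnorm f)).
    exact: finite_measure_integrable_cst.
  have mfL : measurable_fun setT (fun w => f (x + L t w)).
    apply: (measurableT_comp bf.1).
    exact: (measurableT_comp (measurable_translation x) (mL t (ltW t0))).
  have iff := dominated_Rintegrable _ P _ _ mfL if1 (fun w => fsup f _ bf).
  apply: (le_trans (le_normr_Rintegral measurableT iff)).
  apply: le_trans (ltW MN).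
  have -> : supnorm f = \int[P]_w (fun=> supnorm f) w.
    rewrite Rintegral_cst// [X in fine X](_ : _ = 1%E) ?mulr1//.
    exact: probability_setT.
  apply: le_Rintegral => //; first exact: integrable_norm.
  by move=> w _; exact: fsup.
move=> x; have FF := nbhs_filter x.
apply/(@cvgrPdist_le _ _ _ (nbhs x) FF) => eps eps0.
pose K := `|2 * supnorm f * rate_cst d alpha t|.
(* Chosen so that K / T^(alpha - 1) <= eps; the added 1 keeps [T] positive. *)
pose T := (K / eps) `^ (alpha - 1)^-1 + 1.
have a0 : 0 < alpha - 1 by rewrite subr_gt0.
have ln20 := @ln2_gt0 R.
have T0 : 0 < T by rewrite ltr_wpDl// powR_ge0.
(* [expR (- (T * ln 2))] is 2^-T, below which |log2| is at least [T]. Balls here are those of the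
   sup norm, hence the division by d. *)
pose r := Num.min (radius d) (expR (- (T * ln 2))) / d%:R : R.
have d0 : 0 < d%:R :> R by rewrite ltr0n.
have r0 : 0 < r.
  rewrite divr_gt0// lt_min expR_gt0 andbT invr_gt0 exprn_gt0//.
  by rewrite mulrn_wgt0// ltr0n.
apply/nbhs_ballP; exists r => //= y [_ xy].
have er : enorm (x - y) <= Num.min (radius d) (expR (- (T * ln 2))).
  rewrite -[leRHS](divfK (lt0r_neq0 d0)) -/r mulrC.
  apply: enorm_le_coord; first exact: ltW.
  by move=> i; have := xy 0 i; rewrite !mxE => /ltW.
have [e0|e0] := eqVneq (enorm (x - y)) 0.
  have -> : y = x.
    apply/esym/eqP; rewrite -subr_eq0; apply/eqP/rowP => i; rewrite [RHS]mxE.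
    by apply/eqP; rewrite -normr_le0 -e0 norm_coord_le_enorm.
  by rewrite subrr normr0 ltW.
have {}e0 : 0 < enorm (x - y) by rewrite lt_neqAle eq_sym e0 enorm_ge0.
move: er; rewrite le_min => /andP[er1 er2].
have e01 : 0 < enorm (x - y) <= radius d by rewrite e0.
apply: (le_trans (key t f t0 bf x y e01)).
set l := `|log2 (enorm (x - y))|.
have lT : T <= l.
  have h : ln (enorm (x - y)) <= - (T * ln 2).
    by rewrite -[leRHS]expRK ler_ln// posrE expR_gt0.
  have Tl0 : 0 < T * ln 2 by rewrite mulr_gt0.
  rewrite /l /log2 ler0_norm; last by rewrite pmulr_lle0 ?invr_gt0//; lra.
  by rewrite -mulNr ler_pdivlMr//; lra.
have la0 : 0 < l `^ (alpha - 1) by rewrite powR_gt0// (lt_le_trans T0).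
rewrite ler_pdivrMr// (le_trans (ler_norm _))// -/K -ler_pdivrMl// mulrC.
have -> : K / eps = ((K / eps) `^ (alpha - 1)^-1) `^ (alpha - 1).
  have Ke0 : 0 <= K / eps := divr_ge0 (normr_ge0 _) (ltW eps0).
  by rewrite -powRrM mulVf ?lt0r_neq0// powRr1.
apply: ge0_ler_powR; rewrite ?nnegrE ?powR_ge0 ?(ltW a0) ?normr_ge0//.
by apply: le_trans lT; rewrite lerDl.
Qed.
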